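(* Let $k$ be an uncountable field and let $R$ be a finitely generated left noetherian $k$-algebra. Suppose that $\mathrm{Spec}(R)$ is a finite disjoint union of locally closed subsets $X_1,\ldots,X_d$ such that each $X_i$, when endowed with the subspace topology, is homeomorphic to the prime spectrum of an affine (that is, finitely generated) commutative $k$-algebra. Then $R$ satisfies the Dixmier-Moeglin equivalence.
   Context: Algebras are associative and unital. $\mathrm{Spec}(R)$ is the set of (two-sided) prime ideals of $R$ with the Zariski topology, whose closed sets are the sets $\{P : P\supseteq I\}$ for $I$ a two-sided ideal. For a left noetherian $k$-algebra $R$ and $P\in\mathrm{Spec}(R)$: $P$ is locally closed if $\{P\}$ is a locally closed subset of $\mathrm{Spec}(R)$ (equivalently, $P$ is not equal to the intersection of all prime ideals properly containing $P$, where an empty intersection is $R$); $P$ is primitive if it is the annihilator of a simple left $R$-module; $P$ is rational if the centre $Z(Q(R/P))$ of the Goldie ring of quotients $Q(R/P)$ of $R/P$ is an algebraic extension of $k$. The left noetherian $k$-algebra $R$ satisfies the Dixmier-Moeglin equivalence if for every $P\in \mathrm{Spec}(R)$ the three properties ''locally closed'', ''primitive'' and ''rational'' are equivalent. *)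

(* Defs.v *)
From HB Require Import structures.
From mathcomp Require Import all_boot all_order all_algebra.
From mathcomp Require Import all_classical topology.

Set Implicit Arguments.
Unset Strict Implicit.
Unset Printing Implicit Defensive.

Import GRing.Theory.

Local Open Scope classical_set_scope.
Local Open Scope ring_scope.

Section Ideals.
Variable R : nzRingType.
Implicit Types I J P : set R.

(* Closure under opposites follows from closure under left multiplication. *)
Definition left_ideal I :=
  [/\ I 0, forall x y, I x -> I y -> I (x + y) & forall a x, I x -> I (a * x)].

Definition two_sided_ideal I :=
  left_ideal I /\ forall a x, I x -> I (x * a).

Definition left_noetherian :=
  forall I : nat -> set R, (forall n, left_ideal (I n)) ->
    (forall n, I n `<=` I n.+1) ->
    exists N, forall n, (N <= n)%N -> I n = I N.

(* "I J is contained in P" is tested on the products x * y, which generate the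
   ideal I J additively. *)
Definition prime_ideal P :=
  [/\ two_sided_ideal P, P <> setT &
      forall I J, two_sided_ideal I -> two_sided_ideal J ->
        (forall x y, I x -> J y -> P (x * y)) -> I `<=` P \/ J `<=` P].

Record spec := Spec { spec_set :> set R ; spec_prime : prime_ideal spec_set }.

HB.instance Definition _ := gen_eqMixin spec.
HB.instance Definition _ := gen_choiceMixin spec.

Lemma spec_inj (P Q : spec) : (P : set R) = Q -> P = Q.
Proof.
by case: P Q => [P hP] [Q hQ] /= e; subst Q; congr Spec; exact: Prop_irrelevance.
Qed.

Definition zero_locus I : set spec := [set P : spec | I `<=` P].

Definition zariski_open (U : set spec) :=
  exists2 I, two_sided_ideal I & U = ~` zero_locus I.

Lemma two_sided_idealT : two_sided_ideal setT.
Proof. by do 2?split. Qed.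

Lemma zariski_openT : zariski_open setT.
Proof.
exists setT; first exact: two_sided_idealT.
apply/esym; rewrite -subTset => P _ /= PT.
by case: (spec_prime P) => _ + _; apply; apply/seteqP; split.
Qed.

Lemma zariski_openI : setI_closed zariski_open.
Proof.
move=> U V [I iI ->] [J iJ ->]; exists (I `&` J).
  case: iI iJ => [[I0 ID IM] IMr] [[J0 JD JM] JMr]; split; first split.
  - by split.
  - by move=> x y [? ?] [? ?]; split; [apply: ID | apply: JD].
  - by move=> a x [? ?]; split; [apply: IM | apply: JM].
  - by move=> a x [? ?]; split; [apply: IMr | apply: JMr].
rewrite -setCU; congr (~` _); apply/seteqP; split=> P /=.
  by case=> IP x [Ix Jx]; apply: IP.
move=> IJP; case: (spec_prime P) => _ _; apply=> // x y Ix Jy.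
case: iI iJ => [[_ _ IM] IMr] [[_ _ JM] JMr].
by apply: IJP; split; [apply: IMr | apply: JM].
Qed.

Lemma zariski_open_bigU (T : Type) (f : T -> set spec) :
  (forall i, zariski_open (f i)) -> zariski_open (\bigcup_i f i).
Proof.
move=> fo; pose J := \bigcap_(K in [set K | two_sided_ideal K /\
  forall i I, f i = ~` zero_locus I -> two_sided_ideal I -> I `<=` K]) K.
exists J.
  split; first split.
  - by move=> K [[[K0 _ _] _] _].
  - by move=> x y Jx Jy K hK; case: (hK) => -[[_ KD _] _] _;
      apply: KD; [apply: Jx | apply: Jy].
  - by move=> a x Jx K hK; case: (hK) => -[[_ _ KM] _] _; apply: KM; apply: Jx.
  - by move=> a x Jx K hK; case: (hK) => -[_ KM] _; apply: KM; apply: Jx.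
apply/seteqP; split=> P /=.
  move=> [i _]; have [I iI fE] := fo i; rewrite fE /= => nIP JP; apply: nIP.
  by move=> x Ix; apply: JP => K [_ /(_ i I fE iI)]; apply.
move=> nJP; apply: contrapT => nfP; apply: nJP => x Jx; apply: (Jx P).
split; first by case: (spec_prime P).
move=> i I fE iI; apply: contrapT => nIP; apply: nfP; exists i => //.
by rewrite fE.
Qed.

HB.instance Definition _ := isOpenTopological.Build spec
  zariski_openT zariski_openI zariski_open_bigU.

Lemma zariski_closedP (F : set spec) :
  closed F <-> exists2 I, two_sided_ideal I & F = zero_locus I.
Proof.
rewrite -openC; split=> -[I iI FE]; exists I => //; last by rewrite FE.
by rewrite -[F]setCK FE setCK.
Qed.

End Ideals.

Section Topology.

Definition locally_closed (T : topologicalType) (S : set T) :=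
  exists U F : set T, [/\ open U, closed F & S = U `&` F].

Definition homeomorphic (S T : topologicalType) :=
  exists (f : S -> T) (g : T -> S),
    [/\ continuous f, continuous g, cancel f g & cancel g f].

End Topology.

(* The quotient of an algebra by a prime ideal; the library's ring quotients
   are restricted to commutative rings, only its additive part is reused. *)
Section Quotient.
Variables (k : comNzRingType) (R : algType k).

Definition spec_pred (P : spec R) : {pred R} := fun x => `[< spec_set P x >].

Variable P : spec R.

Let idealP : two_sided_ideal P. Proof. by case: (spec_prime P). Qed.

Lemma spec_predMl a x : x \in spec_pred P -> a * x \in spec_pred P.
Proof. by move=> /asboolP Px; apply/asboolP; case: idealP => -[_ _ +] _; apply. Qed.

Lemma spec_predMr a x : x \in spec_pred P -> x * a \in spec_pred P.
Proof. by move=> /asboolP Px; apply/asboolP; case: idealP => _; apply. Qed.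

Lemma spec_pred_zmod_closed : zmod_closed (spec_pred P).
Proof.
split=> [|x y Px Py]; first by apply/asboolP; case: idealP => -[].
have := spec_predMl (-1) Py; rewrite mulN1r => /asboolP Py'.
by move/asboolP: Px => Px; apply/asboolP; case: idealP => -[_ + _] _; apply.
Qed.

HB.instance Definition _ :=
  GRing.isZmodClosed.Build R (spec_pred P) spec_pred_zmod_closed.

Lemma spec_pred1 : 1 \notin spec_pred P.
Proof.
apply/negP => /asboolP P1; case: (spec_prime P) => _ + _; apply.
apply/seteqP; split=> // x _; rewrite -[x]mulr1.
by case: idealP => -[_ _ +] _; apply.
Qed.

Definition quot_spec := @Quotient.quot R (spec_pred P).

HB.instance Definition _ := GRing.Zmodule.on quot_spec.

Definition quot_pi (x : R) : quot_spec := (\pi_quot_spec x)%qT.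
Local Notation pi := quot_pi.

Lemma quot_piP x y : pi x = pi y <-> spec_set P (x - y).
Proof.
rewrite /quot_pi; split=> [/eqP|Pxy].
  by rewrite -Quotient.idealrBE => /asboolP.
by apply/eqP; rewrite -Quotient.idealrBE; apply/asboolP.
Qed.

Lemma quot_pi_surj (u : quot_spec) : exists x, pi x = u.
Proof. by exists (repr u); rewrite /quot_pi reprK. Qed.

Lemma quot_repr_pi x : spec_set P (repr (pi x) - x).
Proof. by apply/quot_piP; rewrite /quot_pi reprK. Qed.

Lemma quot_piD x y : pi (x + y) = pi x + pi y.
Proof. exact: (raddfD (\pi_quot_spec : {additive R -> quot_spec})%qT). Qed.

Definition quot_one : quot_spec := pi 1.
Definition quot_mul (u v : quot_spec) : quot_spec := pi (repr u * repr v).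
Definition quot_scale (a : k) (u : quot_spec) : quot_spec := pi (a *: repr u).

Lemma quot_piM x y : pi (x * y) = quot_mul (pi x) (pi y).
Proof.
have [[_ PD PM] PMr] := idealP.
have [Px Py] := (quot_repr_pi x, quot_repr_pi y).
apply/esym/quot_piP; set x' := repr _; set y' := repr _.
have -> : x' * y' - x * y = (x' - x) * y' + x * (y' - y).
  by rewrite mulrBl mulrBr addrA subrK.
by apply: PD; [apply: PMr | apply: PM].
Qed.

Lemma quot_piZ a x : pi (a *: x) = quot_scale a (pi x).
Proof.
have [[_ PD PM] PMr] := idealP; have Px := quot_repr_pi x.
apply/esym/quot_piP; rewrite -scalerBr -[_ - _]mul1r scalerAl; exact: PM.
Qed.

Lemma quot_mulA : associative quot_mul.
Proof.
move=> u v w; have [x <-] := quot_pi_surj u; have [y <-] := quot_pi_surj v.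
by have [z <-] := quot_pi_surj w; rewrite -!quot_piM mulrA.
Qed.

Lemma quot_mul1 : left_id quot_one quot_mul.
Proof.
by move=> u; have [x <-] := quot_pi_surj u; rewrite -quot_piM mul1r.
Qed.

Lemma quot_mulr1 : right_id quot_one quot_mul.
Proof.
by move=> u; have [x <-] := quot_pi_surj u; rewrite -quot_piM mulr1.
Qed.

Lemma quot_mulDl : left_distributive quot_mul +%R.
Proof.
move=> u v w; have [x <-] := quot_pi_surj u; have [y <-] := quot_pi_surj v.
have [z <-] := quot_pi_surj w.
by rewrite -quot_piD -!quot_piM mulrDl quot_piD.
Qed.

Lemma quot_mulDr : right_distributive quot_mul +%R.
Proof.
move=> u v w; have [x <-] := quot_pi_surj u; have [y <-] := quot_pi_surj v.
have [z <-] := quot_pi_surj w.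
by rewrite -quot_piD -!quot_piM mulrDr quot_piD.
Qed.

Lemma quot_one_neq0 : quot_one != 0.
Proof.
apply/eqP => e; have := spec_pred1; rewrite -[1]subr0.
have : pi 1 = pi 0 by rewrite [LHS]e; apply/esym/(@raddf0 _ _ (\pi_quot_spec : {additive R -> quot_spec})%qT).
by move=> /quot_piP P1; rewrite unfold_in /spec_pred; case: asboolP.
Qed.

HB.instance Definition _ := GRing.Zmodule_isNzRing.Build quot_spec
  quot_mulA quot_mul1 quot_mulr1 quot_mulDl quot_mulDr quot_one_neq0.

Lemma quot_scaleA a b u : quot_scale a (quot_scale b u) = quot_scale (a * b) u.
Proof.
by have [x <-] := quot_pi_surj u; rewrite -!quot_piZ scalerA.
Qed.

Lemma quot_scale1 : left_id 1 quot_scale.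
Proof.
by move=> u; have [x <-] := quot_pi_surj u; rewrite -quot_piZ scale1r.
Qed.

Lemma quot_scaleDr : right_distributive quot_scale +%R.
Proof.
move=> a u v; have [x <-] := quot_pi_surj u; have [y <-] := quot_pi_surj v.
by rewrite -quot_piD -!quot_piZ scalerDr quot_piD.
Qed.

Lemma quot_scaleDl u : {morph quot_scale^~ u : a b / a + b}.
Proof.
move=> a b; have [x <-] := quot_pi_surj u.
by rewrite -!quot_piZ scalerDl quot_piD.
Qed.

HB.instance Definition _ := GRing.Zmodule_isLmodule.Build k quot_spec
  quot_scaleA quot_scale1 quot_scaleDr quot_scaleDl.

Lemma quot_scaleAl (a : k) (u v : quot_spec) : a *: (u * v) = a *: u * v.
Proof.
have [x <-] := quot_pi_surj u; have [y <-] := quot_pi_surj v.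
rewrite /GRing.scale /GRing.mul /=.
by rewrite -!(quot_piM, quot_piZ) scalerAl.
Qed.

HB.instance Definition _ :=
  GRing.Lmodule_isLalgebra.Build k quot_spec quot_scaleAl.

Lemma quot_scaleAr (a : k) (u v : quot_spec) : a *: (u * v) = u * (a *: v).
Proof.
have [x <-] := quot_pi_surj u; have [y <-] := quot_pi_surj v.
rewrite /GRing.scale /GRing.mul /=.
by rewrite -!(quot_piM, quot_piZ) scalerAr.
Qed.

HB.instance Definition _ :=
  GRing.Lalgebra_isAlgebra.Build k quot_spec quot_scaleAr.

Lemma quot_pi_zmod_morphism : zmod_morphism pi.
Proof. exact: (raddfB (\pi_quot_spec : {additive R -> quot_spec})%qT). Qed.

HB.instance Definition _ :=
  GRing.isZmodMorphism.Build R quot_spec pi quot_pi_zmod_morphism.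

Lemma quot_pi_monoid_morphism : monoid_morphism pi.
Proof. by split=> // x y; exact: quot_piM. Qed.

HB.instance Definition _ :=
  GRing.isMonoidMorphism.Build R quot_spec pi quot_pi_monoid_morphism.

Lemma quot_pi_scalable : scalable pi.
Proof. by move=> a x; exact: quot_piZ. Qed.

HB.instance Definition _ :=
  GRing.isScalable.Build k R quot_spec *:%R pi quot_pi_scalable.

End Quotient.

Section Algebras.
Variable k : fieldType.

Definition finitely_generated (A : algType k) :=
  exists s : seq A, forall S : {pred A},
    GRing.subalg_closed S -> {subset s <= S} -> S =i predT.

(* phi exhibits Q as the classical left ring of quotients of S: the elements
   of Q are the fractions phi s ^-1 * phi r with s regular. *)
Definition left_quotient_ring (S : algType k) (Q : unitAlgType k)
    (phi : {lrmorphism S -> Q}) :=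
  [/\ injective phi,
      forall s, GRing.lreg s -> GRing.rreg s -> phi s \is a GRing.unit &
      forall q, exists s r,
        [/\ GRing.lreg s, GRing.rreg s & q = (phi s)^-1 * phi r]].

Definition algebraic_center (Q : algType k) :=
  forall z : Q, (forall x, z * x = x * z) ->
    exists2 p : {poly k}, p != 0 & root (map_poly (in_alg Q) p) z.

Variable R : algType k.
Implicit Types P : spec R.

Definition simple_module (M : lmodType R) :=
  (exists m : M, m != 0) /\
  forall N : {pred M}, GRing.submod_closed N -> N =i pred1 0 \/ N =i predT.

Definition primitive P :=
  exists2 M : lmodType R, simple_module M &
    (P : set R) = [set r | forall m : M, r *: m = 0].

(* By Goldie's theorem the ring of quotients Q(R/P) exists when R is left
   noetherian; it is unique up to an isomorphism of R/P-rings, so the choice of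
   Q is immaterial. *)
Definition rational P :=
  exists (Q : unitAlgType k) (phi : {lrmorphism quot_spec P -> Q}),
    left_quotient_ring phi /\ algebraic_center Q.

Definition dixmier_moeglin :=
  forall P, (locally_closed [set P] <-> primitive P) /\
            (primitive P <-> rational P).

End Algebras.

(* comAlgType excludes the zero algebra, which is affine and has an empty
   spectrum; the first alternative accounts for it. *)
Definition affine_spectrum (k : fieldType) (T : topologicalType) :=
  (T -> False) \/
  exists A : comAlgType k, finitely_generated A /\ homeomorphic T (spec A).

(* Main.v *)
Require Import Defs.
From HB Require Import structures.
From mathcomp Require Import all_boot all_order all_algebra.
From mathcomp Require Import all_classical topology.

(** Let S = R/P, a prime left noetherian algebra of countable dimension, with
    Goldie quotient ring Q. All three implications use Amitsur's trick: over an
    uncountable field the uncountably many resolvents (t - a)^-1 of an element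
    t are linearly dependent in a space of countable dimension, so that t is
    algebraic.

    - locally closed => primitive: a nonzero ideal of S contains a regular
      element c; if c lay in every maximal left ideal, then c - a would be left
      invertible for all a <> 0, so c would be algebraic, hence invertible.
    - primitive => rational: an element of Z(Q) acts, up to denominators, on a
      faithful simple module, whose dimension is countable.
    - rational => locally closed: for every finite-dimensional subspace V of S
      there is f <> 0 such that V meets trivially each prime of S that does not
      contain f. In a minimal counterexample every operator x |-> sum a_i x b_i
      that kills one nonzero element of V kills V, so V = K v with K in Z(Q);
      as Z(Q) is algebraic, f = v x d works, where d clears the denominators of
      K. Letting V exhaust S, countably many f_n outside P isolate P among the
      primes containing it. Under the homeomorphism P corresponds to a prime p
      of an affine commutative algebra A such that p is the only prime
      containing p and avoiding certain a_n outside p. Hence every t - a outside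
      p divides a product of the a_n modulo p; there are only countably many
      such products, so t is algebraic modulo p, and p is maximal. *)

Set Implicit Arguments.
Unset Strict Implicit.
Unset Printing Implicit Defensive.

Import GRing.Theory.
Local Open Scope classical_set_scope.
Local Open Scope ring_scope.

(** * Goldie's theorem for prime left noetherian rings *)

Definition prime_ring (S : nzRingType) :=
  forall x y : S, (forall a, x * a * y = 0) -> x = 0 \/ y = 0.

Definition regular (S : nzRingType) (x : S) := GRing.lreg x /\ GRing.rreg x.

Definition annl (S : nzRingType) (x : S) : set S := [set r | r * x = 0].

(** Essentiality is tested on the principal left ideals [S y] only, since every nonzero left ideal
    contains a nonzero one. *)
Definition essential (S : nzRingType) (E : set S) :=
  left_ideal E /\ forall y, y <> 0 -> exists2 r, r * y <> 0 & E (r * y).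

Lemma left_ideal_annl (S : nzRingType) (x : S) : left_ideal (annl x).
Proof.
split=> [|a b|a b] /=; rewrite /annl /=; first by rewrite mul0r.
  by move=> a0 b0; rewrite mulrDl a0 b0 addr0.
by move=> b0; rewrite -mulrA b0 mulr0.
Qed.

Lemma left_idealN (S : nzRingType) (I : set S) x : left_ideal I -> I x -> I (- x).
Proof. by case=> _ _ IM Ix; rewrite -mulN1r; apply: IM. Qed.

Lemma left_idealB (S : nzRingType) (I : set S) x y :
  left_ideal I -> I x -> I y -> I (x - y).
Proof. by move=> iI Ix Iy; case: (iI) => _ ID _; apply: ID => //; apply: left_idealN. Qed.

(** Were no member above [I0] maximal, a choice of strictly larger members could be iterated into an
    ascending chain that never stops. *)
Lemma noetherian_max (S : nzRingType) (F : set (set S)) (I0 : set S) :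
  left_noetherian S -> (forall I, F I -> left_ideal I) -> F I0 ->
  exists M, [/\ F M, I0 `<=` M & forall J, F J -> M `<=` J -> J `<=` M].
Proof.
move=> noeth Fl FI0; apply: contrapT => nomax.
have step (I : {I | F I /\ I0 `<=` I}) :
    exists J : {I | F I /\ I0 `<=` I}, sval I `<=` sval J /\ ~ sval J `<=` sval I.
  case: I => I [FI I0I] /=; apply: contrapT => nJ; apply: nomax; exists I; split=> //.
  move=> J FJ IJ; apply: contrapT => nJI; apply: nJ.
  by exists (exist _ J (conj FJ (subset_trans I0I IJ))).
have [f fP] := choice step.
pose u n := iter n f (exist _ I0 (conj FI0 (@subset_refl _ I0))).
have [N uN] := noeth (fun n => sval (u n))
  (fun n => Fl _ (proj1 (svalP (u n)))) (fun n => proj1 (fP (u n))).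
by apply: (proj2 (fP (u N))); have /= -> := uN N.+1 (leqnSn N).
Qed.

Section Goldie.
Variable S : nzRingType.
Hypotheses (S_noeth : left_noetherian S) (S_prime : prime_ring S).

(* Utumi: among the nonzero multiples a = y * s of elements y of I, one with a
   maximal left annihilator satisfies a S a = 0. *)
Lemma left_ideal_nonnil (I : set S) (x : S) : left_ideal I -> I x -> x <> 0 ->
  exists2 y, I y & forall n, y ^+ n <> 0.
Proof.
move=> iI Ix x0; apply: contrapT => nil.
have nilI y : I y -> exists n, y ^+ n = 0.
  move=> Iy; apply: contrapT => ny; apply: nil; exists y => // n yn.
  by apply: ny; exists n.
pose F := [set A | exists y s, [/\ I y, y * s <> 0 & A = annl (y * s)]].
have [A [[y [s [Iy ys0 ->]]] _ Amax]] :
    exists M, [/\ F M, annl x `<=` M & forall J, F J -> M `<=` J -> J `<=` M].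
  apply: noetherian_max => // [J [y [s [_ _ ->]]]|]; first exact: left_ideal_annl.
  by exists x, 1; rewrite mulr1; split.
set a := y * s in ys0 Amax.
case: (S_prime (x := a) (y := a)) => // t.
apply: contrapT => ata0.
have Ista : I (s * t * y) by case: iI => _ _; apply.
(* The element [s * t * y] of [I] is nilpotent, and rotating the factors of [y * s * t] carries this
   over to [a * t]. *)
have {nilI}[n nilp] : exists n, (a * t) ^+ n = 0.
  have [n yn] := nilI _ Ista; exists n.+1.
  have comm m : (a * t) ^+ m.+1 = y * (s * t * y) ^+ m * (s * t).
    elim: m => [|m IH]; first by rewrite expr1 expr0 mulr1 /a mulrA.
    by rewrite exprSr IH exprSr /a !mulrA.
  by rewrite comm yn mulr0 mul0r.
have at0 : a * t <> 0 by move=> e; apply: ata0; rewrite e mul0r.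
(* The last nonzero power of [a * t] is again a multiple of [y]. Its left annihilator contains that
   of [a] and also [a * t]; by maximality it equals that of [a], so [a * t * a = 0]. *)
have [m [um0 um1]] : exists m, (a * t) ^+ m.+1 <> 0 /\ (a * t) ^+ m.+2 = 0.
  elim: n nilp => [|[|n] IH] nilp.
  - by case: at0; rewrite -[LHS]mul1r -[1](expr0 (a * t)) nilp mul0r.
  - by case: at0; rewrite -[LHS]expr1.
  - by case: (pselect ((a * t) ^+ n.+1 = 0)) => [/IH //|h]; exists n.
apply: ata0; have e : (a * t) ^+ m.+1 = y * (s * t * (a * t) ^+ m).
  by rewrite exprS /a !mulrA.
apply: (Amax (annl ((a * t) ^+ m.+1))); last by rewrite /annl /= -exprS.
  by exists y, (s * t * (a * t) ^+ m); rewrite -e.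
by move=> r; rewrite /annl /= => ra; rewrite e !mulrA -(mulrA r) ra !mul0r.
Qed.

(** The left annihilators of the powers of [y] form an ascending chain, which stops. The exponent is
    a successor so that the power stays in every left ideal containing [y]. *)
Lemma annl_exp_stable (y : S) :
  exists n, forall r, r * y ^+ n.+1 * y ^+ n.+1 = 0 -> r * y ^+ n.+1 = 0.
Proof.
have [||N yN] := S_noeth (I := fun n => annl (y ^+ n)).
- by move=> n; apply: left_ideal_annl.
- move=> n r; change (r * y ^+ n = 0 -> r * y ^+ n.+1 = 0).
  by rewrite exprSr mulrA => ->; rewrite mul0r.
exists N => r; rewrite -mulrA -exprD => ry.
have : annl (y ^+ (N.+1 + N.+1)) r by [].
rewrite yN; first by rewrite -(yN N.+1).
by rewrite addSn leqW// leq_addr.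
Qed.

Lemma left_ideal_exp (I : set S) y n : left_ideal I -> I y -> I (y ^+ n.+1).
Proof. by move=> [_ _ IM] Iy; rewrite exprSr; apply: IM. Qed.

(** The last condition says that [S y] meets the left annihilator of [y] trivially; such stable
    elements serve as substitutes for idempotents. *)
Lemma left_ideal_stable (I : set S) (x : S) : left_ideal I -> I x -> x <> 0 ->
  exists y, [/\ I y, y <> 0 & forall r, r * y * y = 0 -> r * y = 0].
Proof.
move=> iI Ix x0; have [y Iy yn] := left_ideal_nonnil iI Ix x0.
have [n yS] := annl_exp_stable y.
by exists (y ^+ n.+1); split=> //; exact: left_ideal_exp.
Qed.

(* The element a is grown as a sum of stable elements x with x * a = 0; the
   left ideals L, on which right multiplication by a is injective, increase. *)
Lemma essential_rreg (E : set S) : essential E ->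
  exists2 a, E a & forall r, r * a = 0 -> r = 0.
Proof.
move=> [iE essE].
pose good (L : set S) a := [/\ left_ideal L, E a,
  forall l, L l -> l * a = 0 -> l = 0 & forall r, r * a * a = 0 -> r * a = 0].
have [L [[a [iL Ea La aa]] _ Lmax]] : exists M,
  [/\ [set L | exists a, good L a] M, [set 0] `<=` M &
    forall J, [set L | exists a, good L a] J -> M `<=` J -> J `<=` M].
  apply: noetherian_max => // [I [a []] //|].
  exists 0; split=> [||l -> //|r]; last by rewrite !mulr0.
    split=> [//|x y -> ->|x y ->]; first by rewrite addr0.
    by rewrite mulr0.
  by case: iE.
have Ea0 x : E x -> x * a = 0 -> x = 0.
  move=> Ex xa; apply: contrapT => x0.
  have [|||y [[Ey ya] y0 yy]] := @left_ideal_stable (E `&` annl a) x => //.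
    case: iE (left_ideal_annl a) => E0 ED EM [A0 AD AM].
    split; first by split.
      by move=> u v [? ?] [? ?]; split; [exact: ED|exact: AD].
    by move=> u v [? ?]; split; [exact: EM|exact: AM].
  pose L' := [set z | exists l r, L l /\ z = l + r * y].
  have yL' : L' y by exists 0, 1; rewrite mul1r add0r; split=> //; case: iL.
  have split0 r : r * (a + y) = 0 -> r * a = 0 /\ r * y = 0.
    rewrite mulrDr => e.
    have ra : r * a = 0.
      apply: aa; have := congr1 (fun z => z * a) e.
      by rewrite mulrDl mul0r -[r * y * a]mulrA ya mulr0 addr0.
    by split=> //; move: e; rewrite ra add0r.
  (* The left ideal [L + S y] is again good, with [a + y] as its element, so maximality puts [y] in
     [L], where [y * a = 0] is impossible. *)
  have : L y.
    apply: (Lmax L') yL'; last by move=> l Ll; exists l, 0; rewrite mul0r addr0.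
    case: (iL) => L0 LD LM; exists (a + y); split.
    - split; first by exists 0, 0; rewrite mul0r addr0.
      + move=> _ _ [l [r [Ll ->]]] [l' [r' [Ll' ->]]].
        by exists (l + l'), (r + r'); rewrite mulrDl addrACA; split=> //; exact: LD.
      + move=> u _ [l [r [Ll ->]]].
        by exists (u * l), (u * r); rewrite mulrDr mulrA; split=> //; exact: LM.
    - by case: iE => _ + _; apply.
    - move=> _ [l [r [Ll ->]]] /split0; rewrite !mulrDl -[r * y * a]mulrA ya mulr0 addr0.
      by case=> /(La _ Ll) ->; rewrite mul0r !add0r => /yy.
    - move=> r /split0; rewrite !mulrDr !mulrDl -[r * y * a]mulrA ya mulr0 addr0.
      by case=> /aa ->; rewrite mul0r !add0r => /yy.
  by move=> Ly; apply: y0; apply: La.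
exists a => // r ra; apply: contrapT => r0; have [t tr0 Etr] := essE r r0.
by apply: tr0; apply: Ea0 => //; rewrite -mulrA ra mulr0.
Qed.

(* If S y and S c meet trivially, the left ideals
   S y + S y c + ... + S y c^n are strictly increasing. *)
Lemma essential_principal (c : S) : (forall r, r * c = 0 -> r = 0) ->
  essential [set x | exists r, x = r * c].
Proof.
move=> creg; split.
  split; first by exists 0; rewrite mul0r.
    by move=> _ _ [r ->] [s ->]; exists (r + s); rewrite mulrDl.
  by move=> a _ [r ->]; exists (a * r); rewrite mulrA.
move=> y y0; apply: contrapT => disj.
have {disj}disj r s : r * y = s * c -> r * y = 0.
  by move=> e; apply: contrapT => ry0; apply: disj; exists r => //=; exists s.
pose L := fix L n : set S := if n is n'.+1 then
  [set x | exists r l, L n' l /\ x = r * y + l * c] else [set 0].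
have lL n : left_ideal (L n).
  elim: n => [|n [L0 LD LM]] /=.
    split=> [//|u v -> ->|u v ->]; first by rewrite addr0.
    by rewrite mulr0.
  split; first by exists 0, 0; rewrite !mul0r addr0.
    move=> _ _ [r [l [Ll ->]]] [r' [l' [Ll' ->]]].
    by exists (r + r'), (l + l'); rewrite !mulrDl addrACA; split=> //; exact: LD.
  move=> a _ [r [l [Ll ->]]].
  by exists (a * r), (a * l); rewrite mulrDr !mulrA; split=> //; exact: LM.
have Lsub n : L n `<=` L n.+1.
  elim: n => [|n IH] x /=.
    by move=> ->; exists 0, 0; rewrite !mul0r addr0.
  by move=> [r [l [Ll ->]]]; exists r, l; split=> //; exact: IH.
have [N LN] := S_noeth lL Lsub.
have Lin n : L n.+1 (y * c ^+ n).
  elim: n => [|n IH]; first by exists 1, 0; rewrite mul1r mul0r mulr1 addr0.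
  by exists 0, (y * c ^+ n); rewrite mul0r add0r exprSr mulrA.
(* If [y * c ^+ n.+1 = r * y + l * c], then [(y * c ^+ n - l) * c] lies in both [S y] and [S c], so
   it is zero; cancelling [c] puts [y * c ^+ n] in [L n]. *)
have Lnin n : ~ L n (y * c ^+ n).
  elim: n => [|n IH] /=; first by rewrite mulr1.
  move=> [r [l [Ll e]]]; apply: IH; rewrite (_ : y * c ^+ n = l) //.
  have e' : r * y = (y * c ^+ n - l) * c.
    by rewrite mulrBl -mulrA -exprSr e addrK.
  by apply/subr0_eq/creg; rewrite -e'; apply: disj e'.
by apply: (Lnin N); rewrite -(LN N.+1) //; exact: Lin.
Qed.

(** For a stable [y = t * x] one has [y * t <> 0]. An essential annihilator of [x] would contain
    some [r * y * t <> 0], but then [r * y * y = 0] and stability gives [r * y = 0]. *)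
Lemma nonsingular (x : S) : essential (annl x) -> x = 0.
Proof.
move=> [_ essx]; apply: contrapT => x0.
have iSx : left_ideal [set y | exists r, y = r * x].
  split; first by exists 0; rewrite mul0r.
    by move=> _ _ [r ->] [s ->]; exists (r + s); rewrite mulrDl.
  by move=> a _ [r ->]; exists (a * r); rewrite mulrA.
have Sxx : [set y | exists r, y = r * x] x by exists 1; rewrite mul1r.
have [y [[t yE] y0 yy]] := left_ideal_stable iSx Sxx x0.
have yt0 : y * t <> 0.
  move=> e; apply: y0; rewrite -[LHS]mul1r yy //.
  by rewrite mul1r {2}yE mulrA e mul0r.
have [r ryt0] := essx _ yt0; rewrite /annl /= => e.
apply: ryt0; rewrite mulrA yy ?mul0r //.
by rewrite {2}yE mulrA -[r * y * t]mulrA.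
Qed.

(** If [a * x = a * y], the left annihilator of [x - y] contains the essential left ideal [S a], so
    nonsingularity applies. *)
Lemma rreg_regular (a : S) : (forall r, r * a = 0 -> r = 0) -> regular a.
Proof.
move=> ra; split=> x y e; apply: subr0_eq; last first.
  by apply: ra; rewrite mulrBl e subrr.
apply: nonsingular; split; first exact: left_ideal_annl.
move=> z z0; have [_ /(_ z z0) [r rz0 [s rza]]] := essential_principal ra.
by exists r => //; rewrite rza /annl /= -mulrA mulrBr e subrr mulr0.
Qed.

Lemma regular_rreg (a r : S) : regular a -> r * a = 0 -> r = 0.
Proof. by move=> [_ ra] e; apply: ra; rewrite e mul0r. Qed.

Lemma regular_lreg (a r : S) : regular a -> a * r = 0 -> r = 0.
Proof. by move=> [la _] e; apply: la; rewrite e mulr0. Qed.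

Lemma essential_regular (E : set S) : essential E -> exists2 a, E a & regular a.
Proof. by move=> /essential_rreg[a Ea /rreg_regular]; exists a. Qed.

Definition left_ore :=
  forall c x : S, regular c -> exists d r, regular d /\ d * x = r * c.

(** Because [S c] is essential, so is the left ideal of all [d] with [d * x] in [S c]; it therefore
    contains a regular element. *)
Lemma goldie_left_ore : left_ore.
Proof.
move=> c x creg; have [|d [r e] dreg] := @essential_regular [set d | exists r, d * x = r * c].
  have [_ essc] := essential_principal (fun r => @regular_rreg c r creg).
  split; first split.
  - by exists 0; rewrite !mul0r.
  - by move=> a b [r e] [s e']; exists (r + s); rewrite !mulrDl e e'.
  - by move=> a b [r e]; exists (a * r); rewrite -!mulrA e.
  move=> y y0; have [yx|yx] := pselect (y * x = 0).
    by exists 1; rewrite mul1r //; exists 0; rewrite yx mul0r.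
  have [r ryx [s e]] := essc _ yx; exists r; last by exists s; rewrite -mulrA.
  by move=> ry; apply: ryx; rewrite mulrA ry mul0r.
by exists d, r.
Qed.

(** Primeness makes a nonzero two-sided ideal essential on the left: it contains [x S y], which is
    nonzero for [y <> 0]. *)
Lemma two_sided_regular (I : set S) x : two_sided_ideal I -> I x -> x <> 0 ->
  exists2 c, I c & regular c.
Proof.
case=> iI IMr Ix x0; apply: essential_regular; split=> // y y0.
apply: contrapT => h; suff xay a : x * a * y = 0 by case: (S_prime xay).
by apply: contrapT => xay; apply: h; exists (x * a) => //; apply: (IMr); apply: (IMr).
Qed.

End Goldie.

(** * Ore localization *)

Lemma regularM (S : nzRingType) (a b : S) : regular a -> regular b -> regular (a * b).
Proof. by move=> [la ra] [lb rb]; split; [exact: GRing.lregM|exact: GRing.rregM]. Qed.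

Lemma regular1 (S : nzRingType) : regular (1 : S).
Proof. by split=> x y; rewrite ?mul1r ?mulr1. Qed.

(* A fraction s^-1 r acts by right multiplication as a partial endomorphism of
   the left module S; it is encoded by the graph {(x, y) | x s^-1 r = y}. *)
Section FractionGraphs.
Variable S : nzRingType.
Hypothesis S_ore : left_ore S.
Implicit Types G H K : S -> S -> Prop.

Definition fraction_graph G :=
  [/\ forall a x y x' y', G x y -> G x' y' -> G (a * x + x') (a * y + y'),
      forall y, G 0 y -> y = 0 & exists c y, regular c /\ G c y].

(** Closing under cancellation of regular left factors makes the graph maximal, so that equal
    fractions have equal graphs and no quotient type is needed. *)
Definition saturation G x y := exists2 c, regular c & G (c * x) (c * y).

Definition graph_sub G H := forall x y, G x y -> H x y.

Definition graph_add G H x z := exists y y', [/\ G x y, H x y' & z = y + y'].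
Definition graph_mul G H x z := exists2 y, G x y & H y z.
Definition graph_opp G x y := G x (- y).
Definition graph_of (r x y : S) := y = x * r.
Definition graph_inv (c x y : S) := x = y * c.

Lemma graphZ G a x y : fraction_graph G -> G x y -> G (a * x) (a * y).
Proof.
move=> [Gl _ _] Gxy; have G0 : G 0 0.
  by have := Gl (-1) x y x y Gxy Gxy; rewrite !mulN1r !addNr.
by have := Gl a x y 0 0 Gxy G0; rewrite !addr0.
Qed.

Lemma graph_fun G x y y' : fraction_graph G -> G x y -> G x y' -> y = y'.
Proof.
move=> [Gl G0 _] Gy Gy'; apply: subr0_eq; apply: G0.
by have := Gl (-1) x y' x y Gy' Gy; rewrite !mulN1r addNr addrC.
Qed.

Lemma graph_dense G x : fraction_graph G ->
  exists d y, regular d /\ G (d * x) y.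
Proof.
move=> fG; case: (fG) => _ _ [c [y [creg Gcy]]].
have [d [r [dreg e]]] := S_ore x creg.
by exists d, (r * y); split=> //; rewrite e; exact: graphZ.
Qed.

Lemma sub_saturation G : graph_sub G (saturation G).
Proof. by move=> x y Gxy; exists 1; [exact: regular1|rewrite !mul1r]. Qed.

Lemma fraction_saturation G : fraction_graph G -> fraction_graph (saturation G).
Proof.
move=> fG; case: (fG) => Gl G0 [c0 [y0 [c0reg Gc0]]]; split.
- move=> a x y x' y' [c creg Gxy] [c' c'reg Gxy'].
  have [d [r [dreg e]]] := S_ore a creg.
  have [d' [r' [d'reg e']]] := S_ore d c'reg.
  exists (d' * d); first exact: regularM.
  have Gr z z' : G (c' * z) (c' * z') -> G (d' * d * z) (d' * d * z').
    by rewrite e' -!mulrA; apply: graphZ.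
  rewrite !mulrDr !mulrA -(mulrA d' d a) e -!mulrA !(mulrA d' d).
  by rewrite !(mulrA d' r); apply: Gl => //; apply: Gr.
- by move=> y [c creg]; rewrite mulr0 => /G0 /(regular_lreg creg).
- by exists c0, y0; split=> //; apply: sub_saturation.
Qed.

Lemma saturation_idem G : fraction_graph G ->
  graph_sub (saturation (saturation G)) (saturation G).
Proof.
move=> fG x y [c creg [d dreg]]; rewrite !mulrA => h.
by exists (d * c) => //; exact: regularM.
Qed.

Lemma fraction_add G H : fraction_graph G -> fraction_graph H ->
  fraction_graph (graph_add G H).
Proof.
move=> fG fH; case: (fG) => Gl G0 [c [y [creg Gcy]]]; case: (fH) => Hl H0 _; split.
- move=> a x _ x' _ [y1 [y2 [G1 H1 ->]]] [y3 [y4 [G3 H3 ->]]].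
  exists (a * y1 + y3), (a * y2 + y4); rewrite mulrDr addrACA; split=> //.
    exact: Gl.
  exact: Hl.
- by move=> _ [y1 [y2 [/G0 -> /H0 -> ->]]]; rewrite addr0.
- have [d [y' [dreg Hdc]]] := graph_dense c fH.
  exists (d * c), (d * y + y'); split; first exact: regularM.
  by exists (d * y), y'; split=> //; exact: graphZ.
Qed.

Lemma fraction_mul G H : fraction_graph G -> fraction_graph H ->
  fraction_graph (graph_mul G H).
Proof.
move=> fG fH; case: (fG) => Gl G0 [c [y [creg Gcy]]]; case: (fH) => Hl H0 _; split.
- move=> a x z x' z' [y1 G1 H1] [y2 G2 H2].
  by exists (a * y1 + y2); [exact: Gl|exact: Hl].
- by move=> z [y1 /G0 -> /H0].
- have [d [z [dreg Hdy]]] := graph_dense y fH.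
  exists (d * c), z; split; first exact: regularM.
  by exists (d * y) => //; exact: graphZ.
Qed.

Lemma fraction_opp G : fraction_graph G -> fraction_graph (graph_opp G).
Proof.
move=> [Gl G0 [c [y [creg Gcy]]]]; split.
- by move=> a x y1 x' y2 G1 G2; rewrite /graph_opp opprD -mulrN; apply: Gl.
- by move=> z /G0 /eqP; rewrite oppr_eq0 => /eqP.
- by exists c, (- y); rewrite /graph_opp opprK.
Qed.

Lemma fraction_of r : fraction_graph (graph_of r).
Proof.
split=> [a x y x' y' -> ->|y ->|]; rewrite /graph_of.
- by rewrite mulrDl mulrA.
- by rewrite mul0r.
- by exists 1, r; rewrite mul1r; split=> //; exact: regular1.
Qed.

Lemma fraction_inv c : regular c -> fraction_graph (graph_inv c).
Proof.
move=> creg; split=> [a x y x' y' -> ->|y|]; rewrite /graph_inv.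
- by rewrite mulrDl mulrA.
- by move=> /esym/(regular_rreg creg).
- by exists c, 1; rewrite mul1r.
Qed.

Record fraction := Fraction {
  graph :> S -> S -> Prop;
  graph_fraction : fraction_graph graph;
  graph_saturated : graph_sub (saturation graph) graph }.

(** The Ore condition moves any [x] into the domain of [K], and saturation cancels the multiplier.
    The ring identities of the localization are thus checked on one convenient common graph [K]. *)
Lemma fraction_eq K (p q : fraction) : fraction_graph K ->
  graph_sub K p -> graph_sub K q -> p = q.
Proof.
move=> fK; have sub (p' q' : fraction) : graph_sub K p' -> graph_sub K q' -> graph_sub p' q'.
  move=> Kp Kq x y pxy; apply: graph_saturated.
  have [d [z [dreg Kd]]] := graph_dense x fK; exists d => //.
  rewrite (graph_fun (graph_fraction p') (graphZ d (graph_fraction p') pxy) (Kp _ _ Kd)).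
  exact: Kq.
move=> Kp Kq; have : graph p = graph q.
  by apply/funext => x; apply/funext => y; apply/propext; split; apply: sub.
case: p q {Kp Kq} => [G fG sG] [H fH sH] /= e; subst H.
by congr Fraction; exact: Prop_irrelevance.
Qed.

Definition saturate G (fG : fraction_graph G) : fraction :=
  Fraction (fraction_saturation fG) (saturation_idem fG).

End FractionGraphs.

Section OreLocalization.
Variables (k : fieldType) (S : algType k).

(** The Ore condition is kept in the type so that the ring operations built from it can be attached
    as instances. *)
Definition ore_loc (S_ore : left_ore S) := fraction S.

Variable S_ore : left_ore S.
Local Notation Q := (ore_loc S_ore).
Implicit Types p q r : Q.

HB.instance Definition _ := gen_eqMixin Q.
HB.instance Definition _ := gen_choiceMixin Q.

Definition ore_add p q : Q :=
  saturate S_ore (fraction_add S_ore (graph_fraction p) (graph_fraction q)).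
Definition ore_mul p q : Q :=
  saturate S_ore (fraction_mul S_ore (graph_fraction p) (graph_fraction q)).
Definition ore_opp p : Q := saturate S_ore (fraction_opp (graph_fraction p)).
Definition ore_of (a : S) : Q := saturate S_ore (fraction_of a).
Definition ore_inv (c : S) (creg : regular c) : Q :=
  saturate S_ore (fraction_inv creg).

Lemma ore_addP p q : graph_sub (graph_add p q) (ore_add p q).
Proof. exact: sub_saturation. Qed.
Lemma ore_mulP p q : graph_sub (graph_mul p q) (ore_mul p q).
Proof. exact: sub_saturation. Qed.
Lemma ore_oppP p : graph_sub (graph_opp p) (ore_opp p).
Proof. exact: sub_saturation. Qed.
Lemma ore_ofP a : graph_sub (graph_of a) (ore_of a).
Proof. exact: sub_saturation. Qed.

Let fr p : fraction_graph p := graph_fraction p.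
Let frD G H := @fraction_add S S_ore G H.
Let frM G H := @fraction_mul S S_ore G H.

Lemma ore_addA : associative ore_add.
Proof.
move=> p q r; apply: (fraction_eq S_ore (frD (fr p) (frD (fr q) (fr r)))).
- move=> x _ [y [z [py qrz ->]]]; apply: ore_addP; exists y, z; split=> //.
  exact: ore_addP.
- move=> x _ [y [_ [py [z [z' [qz rz' ->]]] ->]]]; apply: ore_addP.
  by exists (y + z), z'; rewrite addrA; split=> //; apply: ore_addP; exists y, z.
Qed.

Lemma ore_addC : commutative ore_add.
Proof.
move=> p q; apply: (fraction_eq S_ore (frD (fr p) (fr q))); first exact: ore_addP.
by move=> x _ [y [z [py qz ->]]]; apply: ore_addP; exists z, y; rewrite addrC.
Qed.

Lemma ore_add0 : left_id (ore_of 0) ore_add.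
Proof.
move=> p; apply: (fraction_eq S_ore (fr p)) => // x y pxy; apply: ore_addP.
by exists 0, y; rewrite add0r; split=> //; apply: ore_ofP; rewrite /graph_of mulr0.
Qed.

Lemma ore_addN : left_inverse (ore_of 0) ore_opp ore_add.
Proof.
move=> p; apply: (fraction_eq S_ore (frD (fraction_opp (fr p)) (fr p))).
  move=> x _ [y [z [py qz ->]]]; apply: ore_addP; exists y, z; split=> //.
  exact: ore_oppP.
move=> x _ [y [z [py qz ->]]]; apply: ore_ofP; rewrite /graph_of mulr0.
by rewrite (graph_fun (fr p) qz py) subrr.
Qed.

HB.instance Definition _ := GRing.isZmodule.Build Q
  ore_addA ore_addC ore_add0 ore_addN.

Lemma ore_mulA : associative ore_mul.
Proof.
move=> p q r; apply: (fraction_eq S_ore (frM (fr p) (frM (fr q) (fr r)))).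
- move=> x z [y py qrz]; apply: ore_mulP; exists y => //; exact: ore_mulP.
- move=> x w [y py [z qz rw]]; apply: ore_mulP; exists z => //.
  by apply: ore_mulP; exists y.
Qed.

Lemma ore_mul1 : left_id (ore_of 1) ore_mul.
Proof.
move=> p; apply: (fraction_eq S_ore (fr p)) => // x y pxy; apply: ore_mulP.
by exists x => //; apply: ore_ofP; rewrite /graph_of mulr1.
Qed.

Lemma ore_mulr1 : right_id (ore_of 1) ore_mul.
Proof.
move=> p; apply: (fraction_eq S_ore (fr p)) => // x y pxy; apply: ore_mulP.
by exists y => //; apply: ore_ofP; rewrite /graph_of mulr1.
Qed.

Lemma ore_mulDl : left_distributive ore_mul +%R.
Proof.
move=> p q r; apply: (fraction_eq S_ore (frD (frM (fr p) (fr r)) (frM (fr q) (fr r)))).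
- move=> x _ [z [z' [[y py rz] [y' qy' rz'] ->]]]; apply: ore_mulP.
  exists (y + y'); first by apply: ore_addP; exists y, y'.
  by case: (fr r) => /(_ 1 y z y' z' rz rz'); rewrite !mul1r.
- move=> x _ [z [z' [pr qr ->]]]; apply: ore_addP; exists z, z'; split=> //;
  exact: ore_mulP.
Qed.

Lemma ore_mulDr : right_distributive ore_mul +%R.
Proof.
move=> p q r; apply: (fraction_eq S_ore (frM (fr p) (frD (fr q) (fr r)))).
- move=> x w [y py qrw]; apply: ore_mulP; exists y => //; exact: ore_addP.
- move=> x _ [y py [z [z' [qz rz' ->]]]]; apply: ore_addP; exists z, z'.
  by split=> //; apply: ore_mulP; exists y.
Qed.

Lemma ore_of_inj : injective ore_of.
Proof.
move=> a b e; have /= [c creg] : ore_of b 1 a.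
  by rewrite -e; apply: ore_ofP; rewrite /graph_of mul1r.
by rewrite mulr1 => /(proj1 creg).
Qed.

Lemma ore_one_neq0 : ore_of 1 != 0.
Proof. by apply/eqP => /ore_of_inj/eqP; rewrite oner_eq0. Qed.

HB.instance Definition _ := GRing.Zmodule_isNzRing.Build Q
  ore_mulA ore_mul1 ore_mulr1 ore_mulDl ore_mulDr ore_one_neq0.

Lemma ore_of_zmod : zmod_morphism ore_of.
Proof.
move=> a b; apply: (fraction_eq S_ore (fraction_of (a - b))); first exact: ore_ofP.
move=> x y ->; apply: ore_addP; exists (x * a), (- (x * b)).
rewrite mulrBr; split=> //; first exact: ore_ofP.
by apply: ore_oppP; rewrite /graph_opp opprK; exact: ore_ofP.
Qed.

HB.instance Definition _ := GRing.isZmodMorphism.Build S Q ore_of ore_of_zmod.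

Lemma ore_of_monoid : monoid_morphism ore_of.
Proof.
split=> // a b; apply: (fraction_eq S_ore (fraction_of (a * b))); first exact: ore_ofP.
by move=> x y ->; apply: ore_mulP; exists (x * a); apply: ore_ofP; rewrite /graph_of ?mulrA.
Qed.

HB.instance Definition _ := GRing.isMonoidMorphism.Build S Q ore_of ore_of_monoid.

Lemma ore_of_central (a : k) q : ore_of a%:A * q = q * ore_of a%:A.
Proof.
apply: (fraction_eq S_ore (frM (fr q) (fraction_of a%:A))).
- move=> x _ [y qxy ->]; apply: ore_mulP; exists (x * a%:A); first exact: ore_ofP.
  by rewrite !mulr_algr -[a *: x]mulr_algl -[a *: y]mulr_algl; apply: graphZ.
- by move=> x _ [y qxy ->]; apply: ore_mulP; exists y => //; exact: ore_ofP.
Qed.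

Definition ore_scale (a : k) q : Q := ore_of a%:A * q.

Lemma ore_scaleA a b q : ore_scale a (ore_scale b q) = ore_scale (a * b) q.
Proof. by rewrite /ore_scale mulrA -rmorphM -scalerAl mul1r scalerA. Qed.

Lemma ore_scale1 : left_id 1 ore_scale.
Proof. by move=> q; rewrite /ore_scale scale1r rmorph1 mul1r. Qed.

Lemma ore_scaleDr : right_distributive ore_scale +%R.
Proof. by move=> a p q; rewrite /ore_scale mulrDr. Qed.

Lemma ore_scaleDl q : {morph ore_scale^~ q : a b / a + b}.
Proof. by move=> a b; rewrite /ore_scale scalerDl rmorphD mulrDl. Qed.

HB.instance Definition _ := GRing.Zmodule_isLmodule.Build k Q
  ore_scaleA ore_scale1 ore_scaleDr ore_scaleDl.

Lemma ore_scaleAl (a : k) p q : a *: (p * q) = a *: p * q.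
Proof. exact: mulrA. Qed.

HB.instance Definition _ := GRing.Lmodule_isLalgebra.Build k Q ore_scaleAl.

Lemma ore_scaleAr (a : k) p q : a *: (p * q) = p * (a *: q).
Proof. by rewrite [LHS]mulrA ore_of_central -mulrA. Qed.

HB.instance Definition _ := GRing.Lalgebra_isAlgebra.Build k Q ore_scaleAr.

Lemma ore_of_scalable : scalable ore_of.
Proof. by move=> a x; rewrite -mulr_algl rmorphM. Qed.

HB.instance Definition _ :=
  GRing.isScalable.Build k S Q *:%R ore_of ore_of_scalable.

Definition ore_unit : {pred Q} := fun q => `[< exists p, p * q = 1 /\ q * p = 1 >].

Definition ore_invr q : Q :=
  if pselect (exists p, p * q = 1 /\ q * p = 1) is left e then sval (cid e) else q.

Lemma ore_mulVr : {in ore_unit, left_inverse 1 ore_invr *%R}.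
Proof.
move=> q /asboolP h; rewrite /ore_invr; case: pselect => // e.
by case: (svalP (cid e)).
Qed.

Lemma ore_divrr : {in ore_unit, right_inverse 1 ore_invr *%R}.
Proof.
move=> q /asboolP h; rewrite /ore_invr; case: pselect => // e.
by case: (svalP (cid e)).
Qed.

Lemma ore_unitP p q : q * p = 1 /\ p * q = 1 -> p \in ore_unit.
Proof. by move=> h; apply/asboolP; exists q. Qed.

Lemma ore_invr_out : {in [predC ore_unit], ore_invr =1 id}.
Proof. by move=> q /negP h; rewrite /ore_invr; case: pselect => // e; case: h; apply/asboolP. Qed.

HB.instance Definition _ := GRing.NzRing_hasMulInverse.Build Q
  ore_mulVr ore_divrr ore_unitP ore_invr_out.

Lemma ore_of_unit c : regular c -> ore_of c \is a GRing.unit.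
Proof.
move=> creg; apply/unitrP; exists (ore_inv creg); split.
  apply: (fraction_eq S_ore (frM (fraction_inv creg) (fraction_of c))).
    move=> x z [y xy yz]; apply: ore_mulP; exists y; first exact: sub_saturation.
    exact: ore_ofP.
  by move=> x z [y xy ->]; apply: ore_ofP; rewrite /graph_of mulr1 -xy.
apply: (fraction_eq S_ore (fraction_of 1)); last exact: ore_ofP.
move=> x _ ->; apply: ore_mulP; exists (x * c); first exact: ore_ofP.
by apply: sub_saturation; rewrite /graph_inv mulr1.
Qed.

(** A fraction whose graph contains [(c, y)] with [c] regular is [c^-1 y]. *)
Lemma ore_loc_quotient :
  left_quotient_ring (ore_of : {lrmorphism S -> (Q : unitAlgType k)}).
Proof.
split=> [|s ls rs|q]; [exact: ore_of_inj|exact: ore_of_unit|].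
have [_ _ [c [y [creg qcy]]]] := fr q.
exists c, y; split; [exact: (proj1 creg)|exact: (proj2 creg)|].
apply: (mulrI (ore_of_unit creg)); rewrite mulVKr; last exact: ore_of_unit.
apply: (fraction_eq S_ore (fraction_of y)); last exact: ore_ofP.
move=> x _ ->; apply: ore_mulP; exists (x * c); first exact: ore_ofP.
exact: graphZ (fr q) qcy.
Qed.

End OreLocalization.

(** * Linear dependence in spaces of countable dimension *)

Section LinearSpan.
Variables (k : fieldType) (M : lmodType k).
Implicit Types (s t : seq M) (W : set M).

Definition linear_subspace W :=
  W 0 /\ forall (a : k) x y, W x -> W y -> W (a *: x + y).

Fixpoint lspan s : set M :=
  if s is v :: s' then [set x | exists a y, lspan s' y /\ x = a *: v + y]
  else [set 0].

Lemma lspan_subspace s : linear_subspace (lspan s).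
Proof.
elim: s => [|v s [s0 sD]]; split=> //=.
- by move=> a x y -> ->; rewrite scaler0 addr0.
- by exists 0, 0; rewrite scale0r addr0.
- move=> a _ _ [b [x [sx ->]]] [c [y [sy ->]]].
  exists (a * b + c), (a *: x + y); split; first exact: sD.
  by rewrite scalerDr scalerDl scalerA addrACA.
Qed.

Lemma subspaceZ W a x : linear_subspace W -> W x -> W (a *: x).
Proof. by move=> [W0 WD] Wx; rewrite -[a *: x]addr0; apply: WD. Qed.

Lemma subspaceB W x y : linear_subspace W -> W x -> W y -> W (x - y).
Proof. by move=> [_ WD] Wx Wy; rewrite addrC -scaleN1r; apply: WD. Qed.

Lemma lspan_cons v s x : lspan s x -> lspan (v :: s) x.
Proof. by exists 0, x; rewrite scale0r add0r. Qed.

Lemma lspan_head v s : lspan (v :: s) v.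
Proof.
by exists 1, 0; rewrite scale1r addr0; split=> //; case: (lspan_subspace s).
Qed.

Lemma lspan_mem s v : v \in s -> lspan s v.
Proof.
elim: s => // w s IH; rewrite inE => /orP[/eqP ->|/IH]; first exact: lspan_head.
exact: lspan_cons.
Qed.

Lemma lspan_sub s W : linear_subspace W -> (forall v, v \in s -> W v) ->
  lspan s `<=` W.
Proof.
move=> sW; elim: s => [_ x -> |v s IH sub x [a [y [sy ->]]]]; first by case: sW.
case: (sW) => _; apply; first by apply: sub; rewrite mem_head.
by apply: IH sy => w ws; apply: sub; rewrite inE ws orbT.
Qed.

Lemma lspan_mono s t : {subset s <= t} -> lspan s `<=` lspan t.
Proof.
by move=> st; apply: lspan_sub (lspan_subspace t) _ => v /st; exact: lspan_mem.
Qed.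

(** The length of a spanning list stands in for the dimension. In the induction, [W] is either
    inside the span of the tail or spanned by its intersection with that span and one further
    vector. *)
Lemma subspace_lspan s W : linear_subspace W -> W `<=` lspan s ->
  exists t, [/\ lspan t = W, (size t <= size s)%N &
    size t = size s -> lspan s `<=` W].
Proof.
elim: s W => [|v s IH] W sW Ws.
  exists [::]; split=> //= [|_ x ->]; last by case: sW.
  by apply/seteqP; split=> x /= => [->|/Ws]; first by case: sW.
have sU : linear_subspace (W `&` lspan s).
  have [s0 sD] := lspan_subspace s; have [W0 WD] := sW; split; first by split.
  by move=> a x y [? ?] [? ?]; split; [exact: WD|exact: sD].
have [t [tE ts teq]] := IH _ sU (@subIsetr _ _ _).
have [[w [Ww nsw]]|] := pselect (exists w, W w /\ ~ lspan s w); last first.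
  move=> h; exists t; rewrite /= leqW //; split=> //; last first.
    by move=> e; move: ts; rewrite e ltnn.
  rewrite tE; apply/seteqP; split=> [x [] //|x Wx]; split=> //.
  by apply: contrapT => ns; apply: h; exists x.
have [a [y [sy wE]]] := Ws w Ww.
have a0 : a != 0.
  by apply/eqP => a0; apply: nsw; rewrite wE a0 scale0r add0r.
have vE : v = a^-1 *: (w - y) by rewrite wE addrK scalerA mulVf // scale1r.
exists (w :: t); split=> //.
- apply/seteqP; split=> x /=.
    move=> [b [z [tz ->]]]; case: sW => _; apply=> //.
    by move: tz; rewrite tE; case.
  move=> Wx; have [b [z [sz xE]]] := Ws x Wx.
  exists (b / a), (x - (b / a) *: w); split; last by rewrite addrC subrK.
  rewrite tE; split; first by apply: subspaceB => //; exact: subspaceZ.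
  have -> : x - (b / a) *: w = z - (b / a) *: y.
    by rewrite xE wE scalerDr scalerA divfK // opprD addrACA subrr add0r.
  by apply: subspaceB (lspan_subspace s) sz _; exact: subspaceZ (lspan_subspace s) sy.
- move=> /= [e]; have Us := teq e.
  move=> x [b [z [sz ->]]]; case: (sW) => _; apply; last by case: (Us z sz).
  rewrite vE; apply: subspaceZ => //; apply: subspaceB => //.
  by case: (Us y sy).
Qed.

(** Gaussian elimination: some [u j] involving [v] is used to remove [v] from all other vectors,
    which then lie in the span of the tail. *)
Lemma dependent_seq (I : eqType) (u : I -> M) s (l : seq I) : uniq l ->
  (forall i, i \in l -> lspan s (u i)) -> (size s < size l)%N ->
  exists c : I -> k, \sum_(i <- l) c i *: u i = 0 /\ exists2 i, i \in l & c i != 0.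
Proof.
elim: s u l => [|v s IH] u l ul lu sz.
  exists (fun=> 1); split.
    by rewrite big_seq big1 // => i /lu ->; rewrite scaler0.
  by case: l sz {ul lu} => // i l _; exists i; rewrite ?mem_head ?oner_eq0.
have /choice[a] : forall i, exists a, i \in l -> lspan s (u i - a *: v).
  move=> i; have [il|_] := boolP (i \in l); last by exists 0.
  by have [a [y [sy ->]]] := lu i il; exists a; rewrite addrAC subrr add0r.
move=> ha; have [[j jl aj]|h] := pselect (exists2 j, j \in l & a j != 0); last first.
  apply: IH => // [i il|]; last exact: ltnW.
  have := ha i il; rewrite (_ : a i = 0) ?scale0r ?subr0 //.
  by apply/eqP/negP => /negP ai; apply: h; exists i.
have [|i|//|c [cE [i il ci]]] := IH (fun i => u i - (a i / a j) *: u j) (rem j l).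
- exact: rem_uniq.
- rewrite mem_rem_uniq // => /andP[_ il].
  have -> : u i - (a i / a j) *: u j =
      (u i - a i *: v) - (a i / a j) *: (u j - a j *: v).
    by rewrite scalerBr scalerA divfK // opprB addrA subrK.
  by apply: subspaceB (lspan_subspace s) _ _; [exact: ha|apply: subspaceZ (lspan_subspace s) _; exact: ha].
- by rewrite size_rem //; case: (size l) sz.
have ij : i != j by move: il; rewrite mem_rem_uniq // => /andP[].
(* The coefficient at [j] collects the multiples of [u j] subtracted from the other vectors. *)
exists (fun i => if i == j then - \sum_(i <- rem j l) c i * (a i / a j) else c i).
split; last by exists i; rewrite ?(negbTE ij) // (mem_rem il).
rewrite (big_rem j) //= eqxx.
rewrite (eq_big_seq (fun i => c i *: u i)); last first.
  by move=> x; rewrite mem_rem_uniq // => /andP[/negbTE ->].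
rewrite scaleNr scaler_suml -[RHS]cE -sumrN -big_split /=; apply: eq_bigr => x _.
by rewrite scalerBr scalerA addrC.
Qed.

Definition countably_spanned :=
  exists e : nat -> M, forall x, exists n, lspan (mkseq e n) x.

(** As [L] is uncountable, infinitely many of the vectors indexed by it lie in one span of [n]
    vectors; any [n.+1] of these are dependent. *)
Lemma dependent_uncountable (L : set k) (u : k -> M) : countably_spanned ->
  ~ countable L -> exists (l : seq k) (c : k -> k),
    [/\ uniq l, forall i, i \in l -> L i, \sum_(i <- l) c i *: u i = 0 &
        exists2 i, i \in l & c i != 0].
Proof.
move=> [e eP] Lunc.
have [n nfin] : exists n, ~ finite_set [set x | L x /\ lspan (mkseq e n) (u x)].
  apply: contrapT => h; apply: Lunc.
  have -> : L = \bigcup_n [set x | L x /\ lspan (mkseq e n) (u x)].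
    apply/seteqP; split=> [x Lx|x [n _ []] //].
    by have [n] := eP (u x); exists n.
  apply: bigcup_countable => // n _; apply: finite_set_countable.
  by apply: contrapT => nf; apply: h; exists n.
have [B BL Bn] := infinite_set_fset n.+1 nfin.
have [|i iB||c [cE c0]] := @dependent_seq k u (mkseq e n) (finmap.enum_fset B).
- exact: finmap.fset_uniq.
- by case: (BL i).
- by rewrite size_mkseq.
exists (finmap.enum_fset B), c; split=> [|i iB||] //; first exact: finmap.fset_uniq.
by case: (BL i).
Qed.

End LinearSpan.

Lemma countably_spanned_surj (k : fieldType) (M N : lmodType k) (f : {linear M -> N}) :
  (forall y, exists x, f x = y) -> countably_spanned M -> countably_spanned N.
Proof.
move=> fs [e eP]; exists (f \o e) => y; have [x <-] := fs y.
have [n xn] := eP x; exists n; move: x xn; apply: lspan_sub.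
  split; first by rewrite raddf0; case: (lspan_subspace (mkseq (f \o e) n)).
  by move=> a x z sx sz; rewrite linearP; case: (lspan_subspace (mkseq (f \o e) n)) => _; apply.
move=> v /(nthP 0)[i]; rewrite size_mkseq => lin <-; rewrite nth_mkseq //.
by apply: lspan_mem; apply/mapP; exists i; rewrite // mem_iota.
Qed.

Section FinitelyGenerated.
Variables (k : fieldType) (A : algType k).

(** The words in the generators span [A]. They are enumerated by decoding integers as lists of
    indices, with 0 where decoding fails. *)
Lemma finitely_generated_countable : finitely_generated A -> countably_spanned A.
Proof.
move=> [s sP].
pose word (w : seq nat) : A := \prod_(i <- w) nth 0 s i.
pose e n : A := if unpickle n is Some w then word w else 0.
exists e; pose S : {pred A} := fun x => `[< exists n, lspan (mkseq e n) x >].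
have mono m n x : (m <= n)%N -> lspan (mkseq e m) x -> lspan (mkseq e n) x.
  move=> mn; apply: lspan_mono => y /mapP[i]; rewrite mem_iota => /andP[_ im] ->.
  by apply/mapP; exists i => //; rewrite mem_iota (leq_trans im).
have Sword w : word w \in S.
  apply/asboolP; exists (pickle w).+1; apply: lspan_mem; apply/mapP.
  by exists (pickle w); rewrite ?mem_iota //= /e pickleK.
have SS : linear_subspace [set x | x \in S].
  split=> [|a x y /asboolP[m xm] /asboolP[n yn]]; apply/asboolP; first by exists 0.
  exists (maxn m n); case: (lspan_subspace (mkseq e (maxn m n))) => _; apply.
    by apply: mono xm; exact: leq_maxl.
  by apply: mono yn; exact: leq_maxr.
have Se n : e n \in S.
  by rewrite /e; case: unpickle => [w|]; [exact: Sword|case: SS].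
suff SM x y : x \in S -> y \in S -> x * y \in S.
  move=> x; have : x \in S; last by move=> /asboolP.
  rewrite (sP S) //; first split=> //.
  - by have := Sword [::]; rewrite /word big_nil.
  - by move=> a u v; case: SS => _; apply.
  - move=> v /(nthP 0)[i _ <-].
    by have := Sword [:: i]; rewrite /word big_seq1.
move=> /asboolP[m xm] /asboolP[n yn].
have sub W : linear_subspace W -> (forall i, W (e i)) -> forall j, lspan (mkseq e j) `<=` W.
  by move=> sW We j; apply: lspan_sub => // v /mapP[i _ ->].
move: x xm; apply: (@sub [set x | x * y \in S]).
  split=> /= [|a u v uS vS]; first by rewrite mul0r; case: SS.
  by rewrite mulrDl -scalerAl; case: SS => _; apply.
move=> i /=; move: y yn; apply: (@sub [set y | e i * y \in S]).
  split=> /= [|a u v uS vS]; first by rewrite mulr0; case: SS.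
  by rewrite mulrDr -scalerAr; case: SS => _; apply.
move=> j /=; rewrite {1}/e; case: unpickle => [w|]; last by rewrite mul0r; case: SS.
rewrite /e; case: unpickle => [w'|]; last by rewrite mulr0; case: SS.
by have := Sword (w ++ w'); rewrite /word big_cat.
Qed.

End FinitelyGenerated.

(** * Amitsur's trick: algebraicity from dependent resolvents *)

Section Amitsur.
Variable k : fieldType.

(** The numerator of the sum of the [c i / (X - i)] over their common denominator. *)
Definition dependence_poly (l : seq k) (c : k -> k) : {poly k} :=
  \sum_(i <- l) c i *: \prod_(j <- rem i l) ('X - j%:P).

Lemma dependence_poly_neq0 l c : uniq l -> (exists2 i, i \in l & c i != 0) ->
  dependence_poly l c != 0.
Proof.
move=> ul [i il ci]; apply/eqP => /(congr1 (fun p => p.[i])).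
rewrite horner0 horner_sum (big_rem i) //= hornerZ addrC big_seq big1 => [|j]; last first.
  rewrite mem_rem_uniq // => /andP[ji jl].
  rewrite hornerZ horner_prod (big_rem i) /= ?hornerXsubC ?subrr ?mul0r ?mulr0 //.
  by rewrite mem_rem_uniq // inE eq_sym ji.
rewrite add0r => /eqP; rewrite mulf_eq0 (negbTE ci) /= -[_ == 0]/(root _ i).
by rewrite root_prod_XsubC mem_rem_uniq // inE eqxx.
Qed.

(** The [u i] play the role of [s (t - i)^-1]. Multiplying a linear relation between them by the
    product of the [t - j] gives [s q(t) = 0], with [q] the [dependence_poly] of the relation. *)
Lemma resolvents_dependent (B : algType k) (t s : B) (u : k -> B) (L : set k) :
  countably_spanned B -> ~ countable L ->
  (forall i, L i -> u i * (t - i%:A) = s) ->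
  exists2 q : {poly k}, q != 0 & s * horner_alg t q = 0.
Proof.
move=> Bc Lunc ut.
have [l [c [ul lL cu c0]]] := dependent_uncountable u Bc Lunc.
exists (dependence_poly l c); first exact: dependence_poly_neq0.
have := congr1 (fun x => x * horner_alg t (\prod_(j <- l) ('X - j%:P))) cu.
rewrite mul0r mulr_suml => e; rewrite -[RHS]e raddf_sum mulr_sumr /=.
apply: eq_big_seq => i il; rewrite linearZ /= mulr_algl [in RHS](big_rem i) //=.
rewrite rmorphM rmorphB /= horner_algX horner_algC mulrA -scalerAl ut; last exact: lL.
by rewrite -scalerAr -scalerAl.
Qed.

End Amitsur.

(** * Prime ideals and prime quotients *)

Section PrimeIdeals.
Variable R : nzRingType.
Implicit Types P I : set R.

(** Primeness is applied to [I = {z | z R y in P}], which contains [x] under the assumption, and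
    [J = {w | I R w in P}], which contains [y]; this avoids describing generated ideals. *)
Lemma prime_idealP P : prime_ideal P ->
  forall x y, (forall a, P (x * a * y)) -> P x \/ P y.
Proof.
move=> [[iP PMr] _ primeP] x y xy; have [P0 PD PM] := iP.
pose I := [set z | forall a, P (z * a * y)].
have [|||IP|JP] := primeP I [set w | forall z a, I z -> P (z * a * w)].
- split; first split.
  + by move=> a; rewrite !mul0r.
  + by move=> u v Iu Iv a; rewrite !mulrDl; apply: PD; [exact: Iu|exact: Iv].
  + by move=> b u Iu a; rewrite -!mulrA; apply: PM; rewrite mulrA; exact: Iu.
  + by move=> b u Iu a; rewrite -[u * b * a]mulrA; exact: Iu.
- split; first split.
  + by move=> z a _; rewrite mulr0.
  + by move=> u v Ju Jv z a Iz; rewrite mulrDr; apply: PD; [exact: Ju|exact: Jv].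
  + by move=> b u Ju z a Iz; rewrite mulrA -(mulrA z); exact: Ju.
  + by move=> b u Ju z a Iz; rewrite mulrA; apply: PMr; exact: Ju.
- by move=> u v Iu Jv; have := Jv u 1 Iu; rewrite mulr1.
- by left; apply: IP.
- by right; apply: JP => z a; exact.
Qed.

Lemma prime_idealI P : two_sided_ideal P -> ~ P 1 ->
  (forall x y, (forall a, P (x * a * y)) -> P x \/ P y) -> prime_ideal P.
Proof.
move=> iP P1 primeP; split=> // [e|I J [_ IMr] iJ IJ]; first by apply: P1; rewrite e.
apply: contrapT => /not_orP[/existsNP[x /not_implyP[Ix nPx]]].
move=> /existsNP[y /not_implyP[Jy nPy]].
by case: (primeP x y) => // a; apply: IJ => //; exact: IMr.
Qed.

Lemma prime_ideal1 P : prime_ideal P -> ~ P 1.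
Proof.
move=> [[[_ _ PM] _] PT _] P1; apply: PT; apply/seteqP; split=> // x _.
by rewrite -[x]mulr1; apply: PM.
Qed.

End PrimeIdeals.

Section PrimeQuotient.
Variables (k : fieldType) (R : algType k) (P : spec R).
Local Notation pi := (quot_pi P).

Lemma quot_pi0 x : pi x = 0 <-> (P : set R) x.
Proof. by rewrite -(raddf0 pi) quot_piP subr0. Qed.

Lemma quot_spec_prime : prime_ring (quot_spec P).
Proof.
move=> u v; have [x <-] := quot_pi_surj u; have [y <-] := quot_pi_surj v => xy.
rewrite !quot_pi0; apply: (prime_idealP (spec_prime P)) => a.
by apply/quot_pi0; rewrite !rmorphM.
Qed.

Lemma quot_spec_noetherian : left_noetherian R -> left_noetherian (quot_spec P).
Proof.
move=> noeth I iI Iinc; have [n|n x /=|N NE] := noeth (fun n => pi @^-1` I n).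
- case: (iI n) => I0 ID IM; split=> [|x y Ix Iy|a x Ix] /=.
  + by rewrite raddf0.
  + by rewrite raddfD; exact: ID.
  + by rewrite rmorphM; exact: IM.
- exact: Iinc.
exists N => n Nn; apply/seteqP; split=> u; have [x <-] := quot_pi_surj u => Ix.
  by have : (pi @^-1` I n) x by []; rewrite NE.
by have : (pi @^-1` I N) x by []; rewrite -(NE n).
Qed.

Lemma quot_spec_countable : countably_spanned R -> countably_spanned (quot_spec P).
Proof. apply: (countably_spanned_surj (f := pi)); exact: quot_pi_surj. Qed.

End PrimeQuotient.

(** * Locally closed primes are primitive *)

Section CyclicModule.
Variables (R : nzRingType) (L : set R) (iL : left_ideal L).

(** The proof [iL] belongs to the predicate so that the closure instance can be attached to it. *)
Definition left_ideal_pred (iL : left_ideal L) : {pred R} := fun x => `[< L x >].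

Lemma left_ideal_pred_zmod_closed : zmod_closed (left_ideal_pred iL).
Proof.
split=> [|x y /asboolP Lx /asboolP Ly]; apply/asboolP; first by case: iL.
exact: left_idealB.
Qed.

HB.instance Definition _ :=
  GRing.isZmodClosed.Build R (left_ideal_pred iL) left_ideal_pred_zmod_closed.

Definition cyclic_module := @Quotient.quot R (left_ideal_pred iL).

HB.instance Definition _ := GRing.Zmodule.on cyclic_module.

Definition cyclic_pi (x : R) : cyclic_module := (\pi_cyclic_module x)%qT.
Local Notation pi := cyclic_pi.

Lemma cyclic_piP x y : pi x = pi y <-> L (x - y).
Proof.
rewrite /cyclic_pi; split=> [/eqP|Lxy].
  by rewrite -Quotient.idealrBE => /asboolP.
by apply/eqP; rewrite -Quotient.idealrBE; apply/asboolP.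
Qed.

Lemma cyclic_pi_surj (u : cyclic_module) : exists x, pi x = u.
Proof. by exists (repr u); rewrite /cyclic_pi reprK. Qed.

Lemma cyclic_piD x y : pi (x + y) = pi x + pi y.
Proof. exact: (raddfD (\pi_cyclic_module : {additive R -> cyclic_module})%qT). Qed.

Definition cyclic_scale (a : R) (u : cyclic_module) : cyclic_module := pi (a * repr u).

Lemma cyclic_piZ a x : pi (a * x) = cyclic_scale a (pi x).
Proof.
apply/esym/cyclic_piP; rewrite -mulrBr; have [_ _ LM] := iL; apply: LM.
by apply/cyclic_piP; rewrite /cyclic_pi reprK.
Qed.

Lemma cyclic_scaleA a b u : cyclic_scale a (cyclic_scale b u) = cyclic_scale (a * b) u.
Proof. by have [x <-] := cyclic_pi_surj u; rewrite -!cyclic_piZ mulrA. Qed.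

Lemma cyclic_scale1 : left_id 1 cyclic_scale.
Proof. by move=> u; have [x <-] := cyclic_pi_surj u; rewrite -cyclic_piZ mul1r. Qed.

Lemma cyclic_scaleDr : right_distributive cyclic_scale +%R.
Proof.
move=> a u v; have [x <-] := cyclic_pi_surj u; have [y <-] := cyclic_pi_surj v.
by rewrite -cyclic_piD -!cyclic_piZ mulrDr cyclic_piD.
Qed.

Lemma cyclic_scaleDl u : {morph cyclic_scale^~ u : a b / a + b}.
Proof.
by move=> a b; have [x <-] := cyclic_pi_surj u; rewrite -!cyclic_piZ mulrDl cyclic_piD.
Qed.

HB.instance Definition _ := GRing.Zmodule_isLmodule.Build R cyclic_module
  cyclic_scaleA cyclic_scale1 cyclic_scaleDr cyclic_scaleDl.

Lemma cyclic_pi0 x : pi x = 0 <-> L x.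
Proof.
have -> : 0 = pi 0 by rewrite /cyclic_pi raddf0.
by rewrite cyclic_piP subr0.
Qed.

Lemma cyclic_annihilator r : (forall m : cyclic_module, r *: m = 0) <-> forall x, L (r * x).
Proof.
split=> [rm x|rx m]; first by apply/cyclic_pi0; rewrite cyclic_piZ; exact: rm.
have [x <-] := cyclic_pi_surj m; rewrite -[LHS]cyclic_piZ; exact/cyclic_pi0.
Qed.

End CyclicModule.

Definition maximal_left_ideal (R : nzRingType) (L : set R) :=
  [/\ left_ideal L, ~ L 1 &
      forall J, left_ideal J -> ~ J 1 -> L `<=` J -> J `<=` L].

Lemma maximal_left_idealW (R : nzRingType) (I : set R) : left_noetherian R ->
  left_ideal I -> ~ I 1 -> exists L, maximal_left_ideal L /\ I `<=` L.
Proof.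
move=> noeth iI I1.
have [J [iJ _] //|//|L [[iL L1] IL Lmax]] :=
  @noetherian_max R [set J | left_ideal J /\ ~ J 1] I noeth.
by exists L; split=> //; split=> // J iJ J1; apply: Lmax.
Qed.

Section Primitive.
Variables (k : fieldType) (R : algType k).

Lemma cyclic_simple (L : set R) (mL : maximal_left_ideal L) (iL : left_ideal L) :
  @simple_module k R (cyclic_module iL).
Proof.
case: mL => _ L1 Lmax; split.
  by exists (cyclic_pi iL 1); apply/eqP => /cyclic_pi0.
move=> N [N0 ND].
pose J := [set x : R | cyclic_pi iL x \in N].
have iJ : left_ideal J.
  split=> [|x y Jx Jy|a x Jx]; rewrite /J /=.
  - by have /cyclic_pi0 -> : L 0 by have [] := iL.
  - by rewrite cyclic_piD -[cyclic_pi iL x]scale1r ND.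
  - by rewrite cyclic_piZ -[cyclic_scale _ _]addr0; apply: ND.
have [J1|J1] := pselect (J 1).
  right=> u; have [x <-] := cyclic_pi_surj u; rewrite -[x]mulr1.
  by case: iJ => _ _ /(_ x 1 J1).
left=> u; have [x <-] := cyclic_pi_surj u; rewrite inE; apply/idP/eqP => [xN|->//].
apply/cyclic_pi0; apply: (Lmax J) => // y Ly.
by rewrite /J /=; move/cyclic_pi0: Ly => ->.
Qed.

Definition annihilator (M : lmodType R) : set R := [set r | forall m : M, r *: m = 0].

Lemma simple_submod (M : lmodType R) (W : set M) : simple_module M ->
  W 0 -> (forall (a : R) x y, W x -> W y -> W (a *: x + y)) ->
  forall w, W w -> w <> 0 -> W = setT.
Proof.
move=> [_ simpM] W0 WD w Ww w0; pose N : {pred M} := fun x => `[< W x >].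
have [|N0|NT] := simpM N.
- split=> [|a x y /asboolP Wx /asboolP Wy]; apply/asboolP => //; exact: WD.
- by case: w0; apply/eqP; rewrite -[_ == _]/(w \in pred1 0) -N0; apply/asboolP.
- by apply/seteqP; split=> // x _; have := NT x; rewrite unfold_in => /asboolP.
Qed.

Lemma annihilator_prime (M : lmodType R) : simple_module M -> prime_ideal (annihilator M).
Proof.
move=> simpM; apply: prime_idealI.
- split; first split.
  + by move=> m; rewrite scale0r.
  + by move=> x y Ax Ay m; rewrite scalerDl Ax Ay addr0.
  + by move=> a x Ax m; rewrite -scalerA Ax scaler0.
  + by move=> a x Ax m; rewrite -scalerA Ax.
- by move=> A1; case: simpM => -[m /eqP m0] _; apply: m0; rewrite -[m]scale1r A1.
- move=> x y xy; have [|/existsNP[m ym]] := pselect (annihilator M y); first by right.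
  (* The vectors killed by [x R] form a submodule containing [y *: m <> 0], hence all of the simple
     module. *)
  have WT : [set n : M | forall a : R, x *: (a *: n) = 0] = setT.
    apply: (@simple_submod M _ simpM _ _ (y *: m)) => [a|b u v xu xv a|a|] //=.
    + by rewrite !scaler0.
    + by rewrite !scalerDr xv addr0 (scalerA a).
    + by rewrite !scalerA xy.
  left=> n; rewrite -[n]scale1r; have : [set: M] n by [].
  by rewrite -WT.
Qed.

Hypotheses (k_uncountable : ~ countable [set: k]).
Hypotheses (R_countable : countably_spanned R) (R_noeth : left_noetherian R).

Lemma uncountable_nonzero : ~ countable [set a : k | a != 0].
Proof.
move=> c; apply: k_uncountable.
have -> : [set: k] = \bigcup_(b in [set: bool]) (if b then [set 0] else [set a : k | a != 0]).
  apply/seteqP; split=> // a _; have [->|a0] := eqVneq a 0; first by exists true.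
  by exists false.
by apply: bigcup_countable => // -[].
Qed.

(** Write [q = g X^m] with [g(0) <> 0] and cancel [c^m]. Then [g(c) = 0] exhibits the nonzero scalar
    [- g(0)] as a left multiple of [c]. *)
Lemma horner_alg_regular (B : algType k) (c : B) (q : {poly k}) : regular c ->
  q != 0 -> horner_alg c q = 0 -> exists u, u * c = 1.
Proof.
move=> creg q0; have [m [g g0 ->]] := multiplicity_XsubC q 0.
rewrite subr0 in g0 *.
rewrite q0 /= in g0.
rewrite rmorphM rmorphXn /= horner_algX => e.
have gc : horner_alg c g = 0.
  elim: m e => [|m IH]; first by rewrite mulr1.
  by rewrite exprSr mulrA => /(regular_rreg creg).
have : horner_alg c (g - g.[0]%:P) = - (g.[0])%:A.
  by rewrite rmorphB /= gc horner_algC sub0r.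
have /factor_theorem[h ->] : root (g - g.[0]%:P) 0.
  by rewrite /root !hornerE subrr.
rewrite subr0 rmorphM /= horner_algX => hc.
exists (- (g.[0])^-1 *: horner_alg c h); rewrite -scalerAl hc scaleNr scalerN opprK.
by rewrite scalerA mulVf // scale1r.
Qed.

Lemma regular_avoided (P : spec R) (c : R) : regular (quot_pi P c) ->
  exists L, [/\ maximal_left_ideal L, P `<=` L & ~ L c].
Proof.
move=> creg; apply: contrapT => noL.
have {}noL L : maximal_left_ideal L -> P `<=` L -> L c.
  by move=> mL PL; apply: contrapT => nLc; apply: noL; exists L.
have [[P0 PD PM] PMr] : two_sided_ideal P by case: (spec_prime P).
have /choice[u uP] : forall a : k, exists u : quot_spec P,
    a != 0 -> u * (quot_pi P c - a%:A) = 1.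
  move=> a; have [->|a0] := eqVneq a 0; first by exists 0.
  (* This is the left ideal [R (c - a) + P]. A maximal left ideal above it would contain [c] too,
     hence the unit [a]. *)
  pose I := [set x | exists u p, spec_set P p /\ x = u * (c - a%:A) + p].
  have [[v [p [Pp e]]]|I1] := pselect (I 1).
    exists (quot_pi P v) => _; have := congr1 (quot_pi P) e.
    rewrite rmorph1 rmorphD rmorphM /= (_ : quot_pi P p = 0); last exact/quot_pi0.
    by rewrite addr0 rmorphB /= linearZ /= rmorph1 => <-.
  have [|L [mL IL]] := maximal_left_idealW R_noeth _ I1.
    split.
    + by exists 0, 0; rewrite mul0r addr0.
    + move=> _ _ [v [p [Pp ->]]] [w [q [Pq ->]]].
      by exists (v + w), (p + q); rewrite mulrDl addrACA; split=> //; exact: PD.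
    + move=> b _ [v [p [Pp ->]]]; exists (b * v), (b * p).
      by rewrite mulrDr mulrA; split=> //; exact: PM.
  case: (mL) => iL []; rewrite (_ : 1 = a^-1%:A * (c - (c - a%:A))).
    case: (iL) => _ _; apply; apply: left_idealB => //.
      by apply: noL => // x Px; apply: IL; exists 0, x; rewrite mul0r add0r.
    by apply: IL; exists 1, 0; rewrite mul1r addr0.
  by rewrite subKr mulr_algl scalerA mulVf // scale1r.
have [q q0] := resolvents_dependent (@quot_spec_countable k R P R_countable)
  uncountable_nonzero uP.
rewrite mul1r => /(horner_alg_regular creg q0)[v].
have [w <-] := quot_pi_surj v; rewrite -rmorphM -(rmorph1 (quot_pi P)) => /quot_piP wc.
have [//||L [mL PL]] := @maximal_left_idealW R P R_noeth.
  by apply: prime_ideal1; exact: spec_prime.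
case: (mL) => iL []; rewrite -[1](subKr (w * c)).
apply: left_idealB => //; last exact: PL.
by case: (iL) => _ _; apply; exact: noL.
Qed.

Lemma locally_closed_primitive (P : spec R) : locally_closed [set P] -> primitive P.
Proof.
move=> [U [F [[I iI UE] /zariski_closedP[J iJ FE] PE]]].
have : (U `&` F) P by rewrite -PE.
rewrite UE FE => -[/= /existsNP[c0 /not_implyP[Ic0 nPc0]] JP].
(* The image of [I] in [R/P] is nonzero because [P] lies in the open set [U]; it therefore contains
   a regular element. *)
pose I' := [set u | exists2 x, I x & quot_pi P x = u].
have [|||_ [c Ic <-] creg] := @two_sided_regular _ (@quot_spec_noetherian k R P R_noeth)
    (@quot_spec_prime k R P) I' (quot_pi P c0).
- case: iI => -[I0 ID IM] IMr; split; first split.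
  + by exists 0; rewrite ?raddf0.
  + by move=> _ _ [x Ix <-] [y Iy <-]; exists (x + y); [exact: ID|rewrite raddfD].
  + move=> u _ [x Ix <-]; have [a <-] := quot_pi_surj u.
    by exists (a * x); [exact: IM|rewrite rmorphM].
  + move=> u _ [x Ix <-]; have [a <-] := quot_pi_surj u.
    by exists (x * a); [exact: IMr|rewrite rmorphM].
- by exists c0.
- by move=> /quot_pi0.
have [L [mL PL nLc]] := regular_avoided creg.
have iL : left_ideal L by case: mL.
have simpM := cyclic_simple mL iL.
(* The annihilator [Q] contains [P], hence lies in [F]; it misses [c], which is in [I], hence lies
   in [U]. So [Q] is in [U] and [F], that is, [Q = P]. *)
pose Q := Spec (annihilator_prime simpM).
have PQ : P `<=` Q.
  move=> x Px; apply/cyclic_annihilator => y; apply: PL.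
  by case: (spec_prime P) => -[_ +] _ _; apply.
exists (cyclic_module iL : lmodType R) => //.
suff -> : P = Q by [].
apply/esym; have : (U `&` F) Q; last by rewrite -PE.
rewrite UE FE; split=> [IQ|]; last exact: subset_trans PQ.
by apply: nLc; have /cyclic_annihilator/(_ 1) := IQ c Ic; rewrite mulr1.
Qed.

End Primitive.

(** * Primitive primes are rational *)

Lemma horner_alg_central (k : fieldType) (Q : algType k) (z : Q) (f : {poly k}) :
  (forall x, z * x = x * z) -> forall x, horner_alg z f * x = x * horner_alg z f.
Proof.
move=> zC x; elim/poly_ind: f => [|f c IH]; first by rewrite rmorph0 mul0r mulr0.
rewrite rmorphD rmorphM /= horner_algX horner_algC mulrDl mulrDr mulr_algl mulr_algr.
by rewrite -mulrA zC (mulrA _ x z) IH mulrA.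
Qed.

(** * Common denominators of polynomials in a central element *)

Section Denominators.
Variables (k : fieldType) (S Q : algType k) (phi : {lrmorphism S -> Q}).
Variables (z : Q) (s r : S).
Hypotheses (zC : forall x, z * x = x * z) (sz : phi s * z = phi r).

Definition denominator n : set S :=
  [set b | forall f : {poly k}, (size f <= n)%N ->
    exists w, phi b * horner_alg z f = phi w].

(** Right multiples remain denominators because [f(z)] is central. *)
Lemma denominator_ideal n : two_sided_ideal (denominator n).
Proof.
split; first split.
- by move=> f _; exists 0; rewrite rmorph0 mul0r.
- move=> x y Dx Dy f fn; have [u xu] := Dx f fn; have [v yv] := Dy f fn.
  by exists (u + v); rewrite !rmorphD mulrDl xu yv.
- move=> a x Dx f fn; have [u xu] := Dx f fn.
  by exists (a * u); rewrite !rmorphM -mulrA xu.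
- move=> a x Dx f fn; have [u xu] := Dx f fn.
  by exists (u * a); rewrite !rmorphM -mulrA -horner_alg_central // mulrA xu.
Qed.

Lemma denominator1 b : denominator 1 b.
Proof.
move=> f /size1_polyC ->; exists (f`_0 *: b).
by rewrite horner_algC mulr_algr linearZ.
Qed.

(** For [f X + c] in place of [f], centrality turns [b x s f(z) z] into [(b f(z)) x (s z)]. The free
    factor [x] allows the product to be kept outside a given prime ideal. *)
Lemma denominatorS n b x : denominator n b -> denominator n.+1 (b * x * s).
Proof.
move=> Db f; elim/poly_ind: f => [|f c _]; first by exists 0; rewrite !rmorph0 mulr0.
rewrite size_MXaddC => fn.
have {}fn : (size f <= n)%N.
  by move: fn; case: ifP => // /andP[/eqP -> _]; rewrite size_poly0.
have [w bw] := Db f fn; exists (w * x * r + c *: (b * x * s)).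
rewrite [X in _ * X]rmorphD /= [horner_alg z (_ * _)]rmorphM /= horner_algX horner_algC.
rewrite mulrDr mulr_algr.
rewrite linearD linearZ /= !rmorphM /= -bw -sz; congr (_ + _); rewrite -!mulrA.
congr (_ * _); rewrite (mulrA _ (phi x)) (horner_alg_central f zC (phi x)) -!mulrA.
by congr (_ * _); rewrite !mulrA (horner_alg_central f zC (phi s)).
Qed.

End Denominators.

Section PrimitiveRational.
Variables (k : fieldType) (R : algType k) (P : spec R) (M : lmodType R).
Local Notation S := (quot_spec P).
Local Notation pi := (quot_pi P).
Hypotheses (simpM : simple_module M) (PE : (P : set R) = annihilator M).

Definition quot_act (u : S) (m : M) : M := repr u *: m.

Lemma quot_act_pi x m : quot_act (pi x) m = x *: m.
Proof.
apply/eqP; rewrite -subr_eq0 -scalerBl; apply/eqP.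
by have := quot_repr_pi P x; rewrite PE; apply.
Qed.

Lemma quot_actM u v m : quot_act (u * v) m = quot_act u (quot_act v m).
Proof.
have [x <-] := quot_pi_surj u; have [y <-] := quot_pi_surj v.
by rewrite -rmorphM !quot_act_pi scalerA.
Qed.

Lemma quot_actDl u v m : quot_act (u + v) m = quot_act u m + quot_act v m.
Proof.
have [x <-] := quot_pi_surj u; have [y <-] := quot_pi_surj v.
by rewrite -raddfD !quot_act_pi scalerDl.
Qed.

Lemma quot_actDr u m n : quot_act u (m + n) = quot_act u m + quot_act u n.
Proof. exact: scalerDr. Qed.

Lemma quot_actZ (c : k) u m : quot_act (c *: u) m = quot_act u (c%:A *: m).
Proof.
have [x <-] := quot_pi_surj u; rewrite -linearZ /= !quot_act_pi scalerA.
by rewrite mulr_algr.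
Qed.

Lemma quot_act_faithful u : (forall m, quot_act u m = 0) -> u = 0.
Proof.
have [x <-] := quot_pi_surj u => um; apply/quot_pi0; rewrite PE => m.
by rewrite -quot_act_pi.
Qed.

Lemma simple_cyclic m n : m <> 0 :> M -> exists y : R, n = y *: m.
Proof.
move=> m0; have WT : [set n | exists y : R, n = y *: m] = setT.
  apply: (@simple_submod k R M _ simpM _ _ m) => //.
  - by exists 0; rewrite scale0r.
  - move=> a _ _ [y ->] [y' ->]; exists (a * y + y').
    by rewrite scalerDl scalerA.
  - by exists 1; rewrite scale1r.
by have : [set: M] n by []; rewrite -WT.
Qed.

Variables (Q : unitAlgType k) (phi : {lrmorphism S -> Q}).
Hypotheses (k_uncountable : ~ countable [set: k]).
Hypotheses (R_countable : countably_spanned R).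
Hypothesis (Q_quot : left_quotient_ring phi).

(* m' plays the role of (z - a)^-1 m: M need not be a module over Q, so the
   relation is tested after clearing denominators. *)
Lemma center_resolvent (z : Q) (a : k) (m : M) : (forall x, z * x = x * z) ->
  z != a%:A -> exists m', forall w w', phi w' = phi w * (z - a%:A) ->
    quot_act w m = quot_act w' m'.
Proof.
move=> zC za; have [phi_inj phiU frac] := Q_quot.
have zaC x : (z - a%:A) * x = x * (z - a%:A).
  by rewrite mulrBl mulrBr zC mulr_algl mulr_algr.
have [s [r [ls rs zE]]] := frac z.
have sU := phiU s ls rs.
have sr : phi s * (z - a%:A) = phi (r - a *: s).
  by rewrite mulrBr mulr_algr zE mulVKr // rmorphB; congr (_ - _); rewrite -linearZ.
have b0 : r - a *: s <> 0.
  move=> b0; case/negP: za; rewrite -subr_eq0; apply/eqP; apply: (mulrI sU).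
  by rewrite sr b0 rmorph0 mulr0.
(* The vectors admitting a resolvent form a submodule. It contains [b n] for [b = r - a *: s], which
   is [s (z - a)] in [Q], with resolvent [s n]; faithfulness supplies [n] with [b n <> 0]. *)
pose W := [set m | exists m', forall w w', phi w' = phi w * (z - a%:A) ->
    quot_act w m = quot_act w' m'].
suff WT : W = setT by have : [set: M] m by []; rewrite -WT.
have [n bn] : exists n, quot_act (r - a *: s) n <> 0.
  apply: contrapT => h; apply: b0; apply: quot_act_faithful => n.
  by apply: contrapT => bn; apply: h; exists n.
apply: (@simple_submod k R M _ simpM _ _ (quot_act (r - a *: s) n)) => //.
- by exists 0 => w w' _; rewrite /quot_act !scaler0.
- move=> y m1 m2 [m1' h1] [m2' h2]; exists (y *: m1' + m2') => w w' ww'.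
  rewrite !quot_actDr (h2 _ _ ww') -!quot_act_pi -!quot_actM; congr (_ + _).
  by apply: h1; rewrite !rmorphM /= ww' -!mulrA zaC.
- exists (quot_act s n) => w w' ww'; rewrite -!quot_actM; congr (quot_act _ n).
  by apply: phi_inj; rewrite !rmorphM /= ww' -sr -mulrA zaC.
Qed.

Lemma algebraic_center_primitive : algebraic_center Q.
Proof.
move=> z zC; have [phi_inj phiU frac] := Q_quot.
apply: contrapT => nalg.
have {}nalg p : p != 0 -> horner_alg z p <> 0.
  by move=> p0 pz; apply: nalg; exists p => //; apply/eqP.
have za a : z != a%:A.
  apply/eqP => e; apply: (nalg ('X - a%:P)); first by rewrite polyXsubC_eq0.
  by rewrite rmorphB /= horner_algX horner_algC e subrr.
have [[m0 /eqP m00] _] := simpM.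
have /choice[y yP] : forall a, exists y : R, forall w w',
    phi w' = phi w * (z - a%:A) -> quot_act w m0 = quot_act w' (y *: m0).
  move=> a; have [m' m'P] := center_resolvent m0 zC (za a).
  by have [y yE] := simple_cyclic m' m00; exists y; rewrite -yE.
have [l [c [ul _ cy c0]]] := dependent_uncountable y R_countable k_uncountable.
pose q := dependence_poly l c; have q0 : q != 0 by exact: dependence_poly_neq0.
pose g : {poly k} := \prod_(j <- l) ('X - j%:P).
pose gi i : {poly k} := \prod_(j <- rem i l) ('X - j%:P).
have [s [r [ls rs zE]]] := frac z.
have sz : phi s * z = phi r by rewrite zE mulVKr // phiU.
(* With [g] the product of all [X - j], the element [b q(z)] acts on [m0] as [b g(z)] acts on the
   combination of the [y i *: m0], which is zero by [cy]. *)
have kill b : denominator phi z (size l).+1 b ->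
    exists2 u, phi u = phi b * horner_alg z q & quot_act u m0 = 0.
  move=> Db; have [w' bw'] := Db g (eq_leq (size_prod_XsubC l id)).
  have /choice[w bw] : forall i, exists w, i \in l -> phi b * horner_alg z (gi i) = phi w.
    move=> i; have [il|_] := boolP (i \in l); last by exists 0.
    have [|w bw] := Db (gi i); last by exists w.
    by rewrite (size_prod_XsubC (rem i l) id) size_rem // prednK ?leqnSn //; case: (l) il.
  exists (\sum_(i <- l) c i *: w i).
    rewrite /q /dependence_poly !raddf_sum mulr_sumr /=.
    apply: eq_big_seq => i il; rewrite !linearZ /= mulr_algl -bw //.
    by rewrite -scalerAr.
  transitivity (quot_act w' ((\sum_(i <- l) c i *: y i) *: m0)); last first.
    by rewrite cy scale0r /quot_act scaler0.
  have act0 m : quot_act 0 m = 0 by rewrite -(raddf0 pi) quot_act_pi scale0r.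
  rewrite scaler_suml (big_morph (quot_act w') (quot_actDr w') (scaler0 _ _)).
  rewrite (big_morph (quot_act^~ m0) (fun u v => quot_actDl u v m0) (act0 m0)).
  apply: eq_big_seq => i il; rewrite -[c i *: w i]mulr_algl quot_actM.
  rewrite (yP i (w i) w'); last first.
    rewrite -bw' -bw // /g (big_rem i) //= rmorphM rmorphB /= horner_algX horner_algC.
    rewrite -mulrA; congr (_ * _).
    by rewrite mulrBl mulrBr mulr_algl mulr_algr (horner_alg_central _ zC).
  by rewrite -quot_actM mulr_algl quot_actZ scalerA mulr_algl.
(* A power of the denominator [s] of [z] will do, taking the free factor of [denominatorS] to be
   1. *)
have [b [Db bU]] : exists b, denominator phi z (size l).+1 b /\ phi b \is a GRing.unit.
  elim: (size l) => [|n [b [Db bU]]].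
    by exists 1; rewrite rmorph1 unitr1; split=> //; exact: denominator1.
  exists (b * 1 * s); split; first exact: (denominatorS zC sz).
  by rewrite mulr1 rmorphM unitrMr // phiU.
have [u uE _] := kill b Db.
(* Each [b x] is a denominator as well, so [u x] kills [m0] for every [x]; since [m0] generates [M],
   [u] kills [M]. *)
have u0 : u = 0.
  apply: quot_act_faithful => m; have [x ->] := simple_cyclic m m00.
  have Dbx : denominator phi z (size l).+1 (b * pi x).
    by case: (denominator_ideal phi zC (size l).+1) => _; apply.
  have [v vE v0] := kill _ Dbx; rewrite -quot_act_pi -quot_actM -v0.
  congr (quot_act _ m0); apply: phi_inj.
  by rewrite vE !rmorphM /= uE -!mulrA horner_alg_central.
by apply: (nalg q q0); apply: (mulrI bU); rewrite -uE u0 rmorph0 mulr0.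
Qed.

End PrimitiveRational.

Lemma primitive_rational (k : fieldType) (R : algType k) (P : spec R) :
  ~ countable [set: k] -> countably_spanned R -> left_noetherian R ->
  primitive P -> rational P.
Proof.
move=> ku Rc Rn [M simpM PE].
pose hO := goldie_left_ore (quot_spec_noetherian (P := P) Rn) (@quot_spec_prime k R P).
exists (ore_loc hO : unitAlgType k), (@ore_of k _ hO).
split; first exact: ore_loc_quotient.
exact: (algebraic_center_primitive simpM PE ku Rc (ore_loc_quotient hO)).
Qed.

(** * Finite-dimensional subspaces avoided by most primes *)

(** Steinitz exchange: [v] replaces a vector of [s] that occurs in it with nonzero coefficient. *)
Lemma lspan_exchange (k : fieldType) (M : lmodType k) (s : seq M) v :
  lspan s v -> v <> 0 ->
  exists2 t, size s = (size t).+1 & lspan s `<=` lspan (v :: t).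
Proof.
elim: s v => [|x s IH] v /=; first by move=> ->.
move=> [a [y [sy vE]]] v0; have [a0|a0] := eqVneq a 0.
  have sv : lspan s v by rewrite vE a0 scale0r add0r.
  have [t -> st] := IH v sv v0; exists (x :: t) => //.
  move=> _ [b [z [/st [c [w [tw ->]]] ->]]].
  by exists c, (b *: x + w); rewrite addrCA; split=> //; exists b, w.
exists s => // _ [b [z [sz ->]]]; exists (b / a), (z - (b / a) *: y); split.
  by apply: subspaceB (lspan_subspace s) sz _; exact: subspaceZ (lspan_subspace s) sy.
by rewrite vE scalerDr scalerA divfK // -addrA [_ + (z - _)]addrC subrK.
Qed.

Lemma lspan_image (k : fieldType) (M N : lmodType k) (f : {linear M -> N}) s u :
  lspan s u -> lspan (map f s) (f u).
Proof.
elim: s u => [|v s IH] u /=; first by move=> ->; rewrite raddf0.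
by move=> [a [y [sy ->]]]; exists a, (f y); rewrite linearP; split=> //; exact: IH.
Qed.

Section AvoidedSubspaces.
Variables (k : fieldType) (S : algType k).

Definition avoided (V : set S) := exists2 f, f <> 0 &
  forall P : set S, prime_ideal P -> ~ P f -> forall u, V u -> P u -> u = 0.

(** The list [T] stands for a tensor, acting through the bimodule structure of [S]. *)
Definition bimod_op (T : seq (S * S)) (x : S) : S := \sum_(p <- T) p.1 * x * p.2.

Lemma bimod_op_linear T : linear (bimod_op T).
Proof.
move=> a x y; rewrite /bimod_op scaler_sumr -big_split /=; apply: eq_bigr => p _.
by rewrite mulrDr mulrDl -scalerAr -scalerAl.
Qed.

HB.instance Definition _ T :=
  GRing.isLinear.Build k S S *:%R (bimod_op T) (bimod_op_linear T).

Lemma bimod_op_ideal T (I : set S) x : two_sided_ideal I -> I x -> I (bimod_op T x).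
Proof.
move=> [[I0 ID IM] IMr] Ix; apply: (big_ind I) => // p _.
by apply: IMr; exact: IM.
Qed.

Variables (Q : unitAlgType k) (phi : {lrmorphism S -> Q}).
Hypotheses (S_noeth : left_noetherian S) (S_prime : prime_ring S).
Hypotheses (Q_quot : left_quotient_ring phi) (Q_alg : algebraic_center Q).

(** Only the left coefficients are fractions, so left multiplication by one regular element clears
    all denominators. *)
Definition frac_op (T : seq (Q * S)) (x : Q) : Q := \sum_(p <- T) p.1 * x * phi p.2.

Lemma frac_op_mulr T x t :
  frac_op [seq (p.1, p.2 * t) | p <- T] x = frac_op T x * phi t.
Proof.
rewrite /frac_op big_map mulr_suml; apply: eq_bigr => p _ /=.
by rewrite rmorphM mulrA.
Qed.

Lemma frac_op_mull T x t :
  frac_op [seq (t * p.1, p.2) | p <- T] x = t * frac_op T x.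
Proof.
by rewrite /frac_op big_map mulr_sumr; apply: eq_bigr => p _ /=; rewrite !mulrA.
Qed.

Lemma frac_op_cat T T' x : frac_op (T ++ T') x = frac_op T x + frac_op T' x.
Proof. exact: big_cat. Qed.

Lemma phi_unit d : regular d -> phi d \is a GRing.unit.
Proof. by move=> [ld rd]; case: Q_quot => _ + _; apply. Qed.

Lemma frac_denominator (q : Q) : exists d e, regular d /\ phi d * q = phi e.
Proof.
case: Q_quot => _ _ /(_ q)[d [e [ld rd qE]]]; exists d, e; split; first by split.
by rewrite qE mulVKr // phi_unit.
Qed.

Lemma frac_op_clear T : exists d U, regular d /\
  forall x, phi d * frac_op T (phi x) = phi (bimod_op U x).
Proof.
elim: T => [|[q r] T [d [U [dreg dU]]]].
  exists 1, [::]; split=> [|x]; first exact: regular1.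
  by rewrite /frac_op /bimod_op !big_nil mulr0 rmorph0.
have [s [t [sreg st]]] := frac_denominator (phi d * q).
exists (s * d), ((t, r) :: [seq (s * p.1, p.2) | p <- U]).
split=> [|x]; first exact: regularM.
rewrite /frac_op /bimod_op !big_cons big_map mulrDr rmorphD /= !rmorphM /= -st.
rewrite !mulrA; congr (_ + _); rewrite -mulrA dU -rmorphM; congr (phi _).
by rewrite mulr_sumr; apply: eq_bigr => p _; rewrite !mulrA.
Qed.

(** The elements of [S] obtained from [v] by such operators form a nonzero two-sided ideal; it
    contains a regular [c], by which one divides in [Q]. *)
Lemma frac_op_one v : v <> 0 -> exists T, frac_op T (phi v) = 1.
Proof.
move=> v0; pose N := [set a | exists T, phi a = frac_op T (phi v)].
have [|||c [T cT] creg] := two_sided_regular S_noeth S_prime (I := N) (x := v) => //.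
- split; first split.
  + by exists [::]; rewrite rmorph0 /frac_op big_nil.
  + move=> x y [T xT] [U yU]; exists (T ++ U).
    by rewrite frac_op_cat rmorphD /= xT yU.
  + move=> a x [T xT]; exists [seq (phi a * p.1, p.2) | p <- T].
    by rewrite frac_op_mull rmorphM /= xT.
  + move=> a x [T xT]; exists [seq (p.1, p.2 * a) | p <- T].
    by rewrite frac_op_mulr rmorphM /= xT.
- by exists [:: (1, 1)]; rewrite /frac_op big_seq1 /= mul1r rmorph1 mulr1.
exists [seq ((phi c)^-1 * p.1, p.2) | p <- T].
by rewrite frac_op_mull -cT mulVr // phi_unit.
Qed.

(* If 1 = sum q_i v r_i, then c = sum q_i w r_i. *)
Lemma central_ratio v w : v <> 0 ->
  (forall T, bimod_op T v = 0 -> bimod_op T w = 0) ->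
  exists2 c : Q, (forall x, c * x = x * c) & phi w = c * phi v.
Proof.
move=> v0 vw.
have {}vw T : frac_op T (phi v) = 0 -> frac_op T (phi w) = 0.
  have [d [U [dreg dU]]] := frac_op_clear T => Tv.
  have Uv : bimod_op U v = 0.
    by case: Q_quot => phi_inj _ _; apply: phi_inj; rewrite -dU Tv mulr0 rmorph0.
  by apply: (mulrI (phi_unit dreg)); rewrite dU vw // rmorph0 mulr0.
have [T Tv] := frac_op_one v0; pose c := frac_op T (phi w); exists c.
  have cS t : c * phi t = phi t * c.
    apply: subr0_eq.
    have := vw ([seq (p.1, p.2 * t) | p <- T] ++ [seq (- phi t * p.1, p.2) | p <- T]).
    rewrite !frac_op_cat !frac_op_mulr !frac_op_mull Tv !mulNr => -> //.
    by rewrite mul1r mulr1 subrr.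
  move=> x; have [d [e [dreg de]]] := frac_denominator x.
  apply: (mulrI (phi_unit dreg)); rewrite mulrA -cS -mulrA de.
  by rewrite mulrA de cS.
apply/esym; apply: subr0_eq.
have := vw ([seq (p.1, p.2 * v) | p <- T] ++ [:: (-1, 1)]).
rewrite !frac_op_cat !frac_op_mulr Tv /frac_op !big_seq1 /= rmorph1 !mulr1 !mulN1r.
by apply; rewrite mul1r subrr.
Qed.

(** With [c = d^-1 e] and [y = s^-1 r], centrality of [c] turns [c y = 0] into [e S r = 0], and [S]
    is prime. *)
Lemma central_regular (c y : Q) : (forall x, c * x = x * c) -> c <> 0 ->
  c * y = 0 -> y = 0.
Proof.
move=> cC c0 cy; have [phi_inj _ _] := Q_quot.
have [d [e [dreg de]]] := frac_denominator c.
have [s [r [sreg sr]]] := frac_denominator y.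
have [] := S_prime (x := e) (y := r) => [x|e0|r0].
- apply: phi_inj; rewrite !rmorphM /= -de -sr -!mulrA (mulrA c) cC -!mulrA (mulrA c) cC.
  by rewrite -!mulrA cy !mulr0 rmorph0.
- by case: c0; apply: (mulrI (phi_unit dreg)); rewrite de e0 rmorph0 mulr0.
- by apply: (mulrI (phi_unit sreg)); rewrite sr r0 rmorph0 mulr0.
Qed.

Lemma prime_idealPN (P : set S) x y : prime_ideal P -> ~ P x -> ~ P y ->
  exists a, ~ P (x * a * y).
Proof.
move=> pP nPx nPy; apply: contrapT => h; case: (prime_idealP pP (x := x) (y := y)) => // a.
by apply: contrapT => nP; apply: h; exists a.
Qed.

(* If d is not in P then b c h(c) is in P for every denominator b of h(c); with
   h(c) = c^-1, which is a polynomial in c, this puts b itself in P. *)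
Lemma prime_central_ratio (P : set S) (c : Q) d e : prime_ideal P ->
  (forall x, c * x = x * c) -> c <> 0 -> phi d * c = phi e -> P e -> P d.
Proof.
move=> pP cC c0 de Pe; apply: contrapT => nPd.
have [phi_inj _ _] := Q_quot; have [[[P0 PD PM] PMr] _ _] := pP.
have [p p0 pc] := Q_alg cC.
have {}pc : horner_alg c p = 0 by exact/eqP.
have [m [g g0 pE]] := multiplicity_XsubC p 0.
rewrite p0 subr0 in g0 pE; rewrite /= in g0.
have gc : horner_alg c g = 0.
  move: pc; rewrite pE rmorphM rmorphXn /= horner_algX; elim: m {pE} => [|m IH].
    by rewrite mulr1.
  by rewrite exprSr mulrA -cC => /(central_regular cC c0).
have /factor_theorem[h gE] : root (g - g.[0]%:P) 0 by rewrite /root !hornerE subrr.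
rewrite subr0 in gE.
(* Each step multiplies by [d], which is outside [P], after a middle factor given by primeness. The
   start [b = 1] only has to serve the zero polynomial. *)
have [b [Db nPb]] : exists b, denominator phi c (size h) b /\ ~ P b.
  elim: (size h) => [|n [b [Db nPb]]].
    exists 1; split; last exact: prime_ideal1.
    move=> f; rewrite leqn0 size_poly_eq0 => /eqP ->.
    by exists 0; rewrite !rmorph0 mulr0.
  have [a nP] := prime_idealPN pP nPb nPd.
  by exists (b * a * d); split=> //; exact: (denominatorS cC de).
apply: nPb; have [w bw] := Db h (leqnn _).
have ce : horner_alg c h * c = - (g.[0])%:A.
  by rewrite -[X in _ * X]horner_algX -rmorphM -gE rmorphB /= gc horner_algC sub0r.
(* Since [h(c) c = - g(0)], the product [d x (- g(0) b)] equals [e x w], which lies in [P]; and [d]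
   does not. *)
have Pb0 : P (- g.[0] *: b).
  case: (prime_idealP pP (x := d) (y := - g.[0] *: b)) => // x.
  suff -> : d * x * (- g.[0] *: b) = e * x * w by rewrite -mulrA; apply: PMr.
  apply: phi_inj; rewrite !rmorphM /= linearZ /= -de -bw -!mulrA cC -!mulrA.
  congr (_ * (_ * _)); rewrite ce mulrN mulr_algr.
  by rewrite scaleNr.
have -> : b = (- g.[0])^-1%:A * (- g.[0] *: b).
  by rewrite mulr_algl scalerA mulVf ?scale1r // oppr_eq0.
exact: PM.
Qed.

(** Take [f = v x d] with [d] a common denominator of the ratios. If [u = c v] is in [P] and
    [e = d c], then [v y e = u y d] is in [P] for all [y], so [e] is in [P], and for [c <> 0] so is
    [d], a contradiction. *)
Lemma avoided_central_multiples s v : v <> 0 ->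
  (forall u, lspan s u -> exists2 c : Q, (forall x, c * x = x * c) & phi u = c * phi v) ->
  avoided (lspan s).
Proof.
move=> v0 sv; have [phi_inj _ _] := Q_quot.
pose good d u := exists c e, [/\ forall x, c * x = x * c, phi u = c * phi v & phi d * c = phi e].
have good_sub d : linear_subspace (good d).
  split.
    by exists 0, 0; rewrite rmorph0 !mul0r mulr0; split=> // x; rewrite mul0r mulr0.
  move=> a x y [c [e [cC xc de]]] [c' [e' [cC' yc de']]].
  exists (a *: c + c'), (a *: e + e'); split.
  - by move=> z; rewrite mulrDl mulrDr -scalerAl -scalerAr cC cC'.
  - by rewrite linearP /= xc yc mulrDl scalerAl.
  - by rewrite linearP /= -de -de' mulrDr scalerAr.
have [d dreg dgood] : exists2 d, regular d & forall u, u \in s -> good d u.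
  have : forall u, u \in s -> lspan s u by move=> u; exact: lspan_mem.
  elim: {1 3}s => [_|w t IH ws]; first by exists 1; [exact: regular1|].
  have [u ut|d dreg dt] := IH; first by apply: ws; rewrite inE ut orbT.
  have [c cC wc] := sv w (ws w (mem_head _ _)).
  have [r [e [rreg re]]] := frac_denominator (phi d * c).
  exists (r * d) => [|u]; first exact: regularM.
  rewrite inE => /orP[/eqP ->|/dt [c' [e' [cC' uc de]]]].
    by exists c, e; rewrite rmorphM -mulrA.
  by exists c', (r * e'); rewrite !rmorphM /= -mulrA de.
have {}dgood u : lspan s u -> good d u by apply: lspan_sub.
have [x vxd] : exists x, v * x * d <> 0.
  apply: contrapT => h; case: (S_prime (x := v) (y := d)) => [x|//|d0].
    by apply: contrapT => nz; apply: h; exists x.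
  by move: (phi_unit dreg); rewrite d0 rmorph0 unitr0.
exists (v * x * d) => // P pP nPf u su Pu.
have [[[P0 PD PM] PMr] _ _] := pP.
have nPv : ~ P v by move=> Pv; apply: nPf; rewrite -mulrA; exact: PMr.
have nPd : ~ P d by move=> Pd; apply: nPf; exact: PM.
have [c [e [cC uc de]]] := dgood u su.
have [c0|c0] := pselect (c = 0).
  by apply: phi_inj; rewrite uc c0 mul0r rmorph0.
case: nPd; apply: (prime_central_ratio pP cC c0 de).
case: (prime_idealP pP (x := v) (y := e)) => // y.
suff -> : v * y * e = u * y * d by rewrite -mulrA; apply: PMr.
by apply: phi_inj; rewrite !rmorphM /= uc -de !mulrA -cC !mulrA.
Qed.

(** Induction on the length of [s]. If an operator kills a nonzero vector of the span but not the
    whole span, its image and its kernel there have shorter spanning lists, yielding [f] and [g]. A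
    nonzero [f x g] works: for [u] in [P], first [T u = 0] by [f], then [u = 0] by [g]. *)
Lemma avoided_lspan s : avoided (lspan s).
Proof.
have [n] := ubnP (size s); elim: n s => // n IH s; rewrite ltnS => sn.
have [s0|] := pselect (forall u, lspan s u -> u = 0).
  by exists 1 => [/eqP|P _ _ u /s0]; rewrite ?oner_eq0.
move=> /existsNP[v /not_implyP[sv v0]].
have [[T [Tv [w [sw Tw]]]]|noT] := pselect (exists T, bimod_op T v = 0 /\
    exists w, lspan s w /\ bimod_op T w <> 0); last first.
  apply: (avoided_central_multiples v0) => u su; apply: central_ratio => // T Tv.
  by apply: contrapT => Tu; apply: noT; exists T; split=> //; exists u.
have [t st tP] := lspan_exchange sv v0.
have [|f f0 fP] := IH (map (bimod_op T) t); first by rewrite size_map -st.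
pose K := [set u | lspan s u /\ bimod_op T u = 0].
have [|u []//|r [rE rs rsub]] := @subspace_lspan k S s K.
  have [s0 sD] := lspan_subspace s.
  split=> [|a x y [sx Tx] [sy Ty]]; first by rewrite /K /= raddf0.
  by split; [exact: sD|rewrite linearP /= Tx Ty scaler0 addr0].
have [|g g0 gP] := IH r.
  apply: leq_trans sn; rewrite ltn_neqAle rs andbT; apply/eqP => e.
  by case: (rsub e w sw).
have [x fxg] : exists x, f * x * g <> 0.
  apply: contrapT => h; case: (S_prime (x := f) (y := g)) => // x.
  by apply: contrapT => nz; apply: h; exists x.
exists (f * x * g) => // P pP nP u su Pu; have [iP _ _] := pP.
have [[P0 PD PM] PMr] := iP.
have nPf : ~ P f by move=> Pf; apply: nP; rewrite -mulrA; exact: PMr.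
have nPg : ~ P g by move=> Pg; apply: nP; exact: PM.
apply: (gP P pP nPg) => //; rewrite rE; split=> //.
apply: (fP P pP nPf); last exact: bimod_op_ideal.
have [a [y [ty ->]]] := tP u su.
by rewrite linearP /= Tv scaler0 add0r; apply: lspan_image.
Qed.

End AvoidedSubspaces.

(** * Rational primes are locally closed *)

Lemma ideal_disjoint_max (R : nzRingType) (I B : set R) :
  two_sided_ideal I -> (forall x, I x -> ~ B x) ->
  exists M, [/\ two_sided_ideal M, I `<=` M, forall x, M x -> ~ B x &
    forall J, two_sided_ideal J -> M `<=` J -> (forall x, J x -> ~ B x) -> J `<=` M].
Proof.
move=> iI IB.
pose good X := [/\ two_sided_ideal X, I `<=` X & forall x, X x -> ~ B x].
have [M [[M0|[iM IM MB]] Mmax]] : exists M, (M = set0 \/ good M) /\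
    forall J, M `<` J -> ~ (J = set0 \/ good J).
- apply: Zorn_bigcup => F FP Ftot.
  have [[X0 [FX0 gX0]]|noX] := pselect (exists X, F X /\ good X); last first.
    left; apply/seteqP; split=> // x [X FX Xx].
    by case: (FP X FX) => [e|gX]; [rewrite e in Xx|case: noX; exists X].
  have Fgood X x : F X -> X x -> good X.
    by move=> FX Xx; case: (FP X FX) => // e; rewrite e in Xx.
  right; split.
  + split; first split.
    * by exists X0 => //; case: gX0 => -[[]].
    * move=> x y [X FX Xx] [Y FY Yy].
      have [XY|YX] := Ftot X Y FX FY.
        by exists Y => //; case: (Fgood Y y FY Yy) => -[[_ YD _] _] _ _; apply: YD => //; exact: XY.
      by exists X => //; case: (Fgood X x FX Xx) => -[[_ XD _] _] _ _; apply: XD => //; exact: YX.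
    * move=> a x [X FX Xx]; exists X => //.
      by case: (Fgood X x FX Xx) => -[[_ _ XM] _] _ _; apply: XM.
    * move=> a x [X FX Xx]; exists X => //.
      by case: (Fgood X x FX Xx) => -[_ XMr] _ _; apply: XMr.
  + by move=> x Ix; exists X0 => //; case: gX0 => _ + _; apply.
  + by move=> x [X FX Xx]; case: (Fgood X x FX Xx) => _ _; apply.
- exfalso; apply: (Mmax I); last by right; split.
  by rewrite M0; split=> // I0; case: iI => -[/I0].
exists M; split=> // J iJ MJ JB; apply: contrapT => nJM.
apply: (Mmax J); first by split.
by right; split=> //; exact: subset_trans MJ.
Qed.

(** * Primes of a commutative algebra isolated by countably many elements *)

Section AffineMaximal.
Variables (k : fieldType) (A : comAlgType k).
Hypotheses (k_uncountable : ~ countable [set: k]) (A_countable : countably_spanned A).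
Variables (p : spec A) (a : nat -> A).
Hypotheses (pa : forall n, ~ (p : set A) (a n)).
Hypothesis p_max : forall q : spec A, p `<=` q -> (forall n, ~ (q : set A) (a n)) -> q `<=` p.

Definition monomial_in (w : seq nat) : A := \prod_(n <- w) a n.

Lemma monomial_in_cat v w : monomial_in (v ++ w) = monomial_in v * monomial_in w.
Proof. exact: big_cat. Qed.

Lemma com_prime (q : spec A) x y : (q : set A) (x * y) -> (q : set A) x \/ (q : set A) y.
Proof.
move=> qxy; apply: (prime_idealP (spec_prime q)) => b.
by rewrite mulrAC; case: (spec_prime q) => -[_ qMr] _ _; apply: qMr.
Qed.

Lemma monomial_in_notin w : ~ (p : set A) (monomial_in w).
Proof.
rewrite /monomial_in; elim: w => [|n w IH].
  by rewrite big_nil; apply: prime_ideal1; exact: spec_prime.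
by rewrite big_cons => /com_prime[/pa|].
Qed.

(* Otherwise a prime containing p and t avoids all a n, by Krull's argument. *)
Lemma monomial_in_adjoin (t : A) : ~ (p : set A) t ->
  exists u w, (p : set A) (u * t - monomial_in w).
Proof.
move=> npt; apply: contrapT => nuw.
have adj_ideal (I : set A) x : two_sided_ideal I ->
    two_sided_ideal [set z | exists u m, I m /\ z = u * x + m].
  move=> [[I0 ID IM] IMr]; split; first split.
  - by exists 0, 0; rewrite mul0r addr0.
  - move=> _ _ [u [m [Im ->]]] [v [n [In ->]]]; exists (u + v), (m + n).
    by rewrite mulrDl addrACA; split=> //; exact: ID.
  - move=> b _ [u [m [Im ->]]]; exists (b * u), (b * m).
    by rewrite mulrDr mulrA; split=> //; exact: IM.
  - move=> b _ [u [m [Im ->]]]; exists (b * u), (b * m).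
    by split; [exact: IM|rewrite mulrC mulrDr mulrA].
have [ip _ _] := spec_prime p.
have [||M [iM IM MB Mmax]] := @ideal_disjoint_max A
    [set z | exists u m, (p : set A) m /\ z = u * t + m]
    [set x | exists w, x = monomial_in w].
- exact: adj_ideal.
- move=> _ [u [m [pm ->]]] [w e]; apply: nuw; exists u, w.
  rewrite -e opprD addrA subrr add0r.
  by case: ip => [ip1 _]; apply: left_idealN.
have [[M0 MD MM] MMr] := iM.
have pM : prime_ideal M.
  apply: prime_idealI => // [M1|x y xy].
    by apply: (MB 1) => //; exists [::]; rewrite /monomial_in big_nil.
  apply: contrapT => /not_orP[nMx nMy].
  have meet z : ~ M z -> exists u m w, M m /\ u * z + m = monomial_in w.
    move=> nMz; apply: contrapT => nz; apply: nMz.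
    apply: (Mmax _ (adj_ideal M z iM)); last by exists 1, 0; rewrite mul1r addr0.
      by move=> m Mm; exists 0, m; rewrite mul0r add0r.
    move=> _ [u [m [Mm ->]]] [w e]; apply: nz; by exists u, m, w.
  have [u [m [w [Mm e]]]] := meet x nMx.
  have [u' [m' [w' [Mm' e']]]] := meet y nMy.
  apply: (MB (monomial_in (w ++ w'))); last by exists (w ++ w').
  rewrite monomial_in_cat -e -e' mulrDr; apply: (MD); last exact: MM.
  rewrite mulrDl; apply: (MD); last exact: MMr.
  have := MM (u * u') _ (xy 1); rewrite mulr1; congr M.
  by rewrite -!mulrA; congr (_ * _); rewrite mulrCA.
have nMa n : ~ M (a n).
  by move=> Ma; apply: (MB (a n)) => //; exists [:: n]; rewrite /monomial_in big_seq1.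
apply: npt; apply: (p_max (q := Spec pM)) => //= [x px|].
  by apply: IM; exists 0, x; rewrite mul0r add0r.
apply: IM; exists 1, 0; rewrite mul1r addr0; split=> //; by case: ip => -[].
Qed.

Lemma maximal_of_countable (t : A) : ~ (p : set A) t ->
  exists b, (p : set A) (b * t - 1).
Proof.
move=> npt.
have quotC (u v : quot_spec p) : u * v = v * u.
  have [x <-] := quot_pi_surj u; have [y <-] := quot_pi_surj v.
  by rewrite -!rmorphM mulrC.
have quot_dom (u v : quot_spec p) : u * v = 0 -> u = 0 \/ v = 0.
  by move=> uv; apply: quot_spec_prime => w; rewrite -mulrA quotC -mulrA (quotC v) uv mulr0.
(* A [t] congruent to a scalar is inverted directly; otherwise every [t - c] is outside [p] and has
   a resolvent. *)
have [[c pc]|nc] := pselect (exists c : k, (p : set A) (t - c%:A)).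
  have c0 : c != 0 by apply/eqP => c0; apply: npt; rewrite c0 scale0r subr0 in pc.
  exists (c^-1)%:A; have -> : (c^-1)%:A * t - 1 = (c^-1)%:A * (t - c%:A).
    by rewrite mulrBr !mulr_algl scalerA mulVf // scale1r.
  by case: (spec_prime p) => -[[_ _ pM] _] _ _; apply: pM.
have /choice[uw uwP] : forall c : k, exists uw : A * seq nat,
    (p : set A) (uw.1 * (t - c%:A) - monomial_in uw.2).
  move=> c; have [|u [w uwP]] := @monomial_in_adjoin (t - c%:A); last by exists (u, w).
  by move=> pc; apply: nc; exists c.
(* There are only countably many words, so one product is the common numerator of uncountably many
   resolvents. *)
have [w wunc] : exists w, ~ countable [set c | (uw c).2 = w].
  apply: contrapT => h; apply: k_uncountable.
  have -> : [set: k] = \bigcup_(w in [set: seq nat]) [set c | (uw c).2 = w].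
    by apply/seteqP; split=> // c _; exists (uw c).2.
  by apply: bigcup_countable => // w _; apply: contrapT => nw; apply: h; exists w.
have [|q q0 qE] := @resolvents_dependent k (quot_spec p) (quot_pi p t)
    (quot_pi p (monomial_in w)) (fun c => quot_pi p (uw c).1) _
    (@quot_spec_countable k A p A_countable) wunc.
  move=> c <-; have /quot_piP <- := uwP c.
  by rewrite rmorphM rmorphB /=; congr (_ * (_ - _)); rewrite linearZ /= rmorph1.
have treg : regular (quot_pi p t).
  have t0 : quot_pi p t <> 0 by move=> /quot_pi0.
  split=> x y e; apply: subr0_eq.
    by case: (quot_dom (quot_pi p t) (x - y)) => //; rewrite mulrBr e subrr.
  by case: (quot_dom (x - y) (quot_pi p t)) => //; rewrite mulrBl e subrr.
have {}qE : horner_alg (quot_pi p t) q = 0.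
  by case: (quot_dom _ _ qE) => // /quot_pi0 /monomial_in_notin.
have [v] := horner_alg_regular treg q0 qE.
have [b <-] := quot_pi_surj v; rewrite -rmorphM -(rmorph1 (quot_pi p)) => /quot_piP.
by exists b.
Qed.

Lemma affine_point_closed : closed [set p].
Proof.
apply/zariski_closedP; exists (p : set A); first by case: (spec_prime p).
apply/seteqP; split=> [_ -> //|q pq]; apply: spec_inj; apply/seteqP; split=> // t qt.
apply: contrapT => /maximal_of_countable[b /pq pb].
apply: (prime_ideal1 (spec_prime q)); rewrite -[1](subKr (b * t)).
have [[iq _] _ _] := spec_prime q.
by apply: left_idealB => //; case: iq => _ _; apply.
Qed.

End AffineMaximal.

Section RationalLocallyClosed.
Variables (k : fieldType) (R : algType k).
Hypotheses (k_uncountable : ~ countable [set: k]).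
Hypotheses (R_countable : countably_spanned R) (R_noeth : left_noetherian R).

(** The defining ideal is the one generated by [x], written as an intersection. *)
Lemma closed_contains (x : R) : closed [set Q : spec R | (Q : set R) x].
Proof.
apply/zariski_closedP; exists [set y | forall J, two_sided_ideal J -> J x -> J y].
  split; first split.
  - by move=> J [[]].
  - by move=> u v Iu Iv J iJ Jx; case: (iJ) => -[_ JD _] _; apply: JD; [exact: Iu|exact: Iv].
  - by move=> b u Iu J iJ Jx; case: (iJ) => -[_ _ JM] _; apply: JM; exact: Iu.
  - by move=> b u Iu J iJ Jx; case: (iJ) => _ JM; apply: JM; exact: Iu.
apply/seteqP; split=> [Q Qx y|Q IQ] /=.
  by apply => //; case: (spec_prime Q).
by apply: IQ => J _.
Qed.

Lemma quot_image_prime (P Q : spec R) : P `<=` Q ->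
  prime_ideal [set u : quot_spec P | (Q : set R) (repr u)] /\
  forall x, (Q : set R) (repr (quot_pi P x)) <-> (Q : set R) x.
Proof.
move=> PQ; have [iQ _ _] := spec_prime Q; have [[Q0 QD QM] QMr] := iQ.
have Qpi x : (Q : set R) (repr (quot_pi P x)) <-> (Q : set R) x.
  have Qd := PQ _ (quot_repr_pi P x); split=> Qx.
    by rewrite -[x](subKr (repr (quot_pi P x))); apply: left_idealB.
  by rewrite -[repr _](subrK x); apply: QD.
split=> //; apply: prime_idealI => /=.
- split; first split.
  + by rewrite -(raddf0 (quot_pi P)) /= Qpi.
  + move=> u v; have [x <-] := quot_pi_surj u; have [y <-] := quot_pi_surj v.
    by rewrite /= -rmorphD !Qpi; apply: QD.
  + move=> u v; have [x <-] := quot_pi_surj u; have [y <-] := quot_pi_surj v.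
    by rewrite /= -rmorphM !Qpi; apply: QM.
  + move=> u v; have [x <-] := quot_pi_surj u; have [y <-] := quot_pi_surj v.
    by rewrite /= -rmorphM !Qpi; apply: QMr.
- by rewrite /= -(rmorph1 (quot_pi P)) Qpi; apply: prime_ideal1; exact: spec_prime.
- move=> u v; have [x <-] := quot_pi_surj u; have [y <-] := quot_pi_surj v => xy.
  rewrite /= !Qpi; apply: (prime_idealP (spec_prime Q)) => b.
  by rewrite -Qpi !rmorphM.
Qed.

(** [F n] comes from [avoided_lspan] for the first [n] vectors of a spanning sequence of [R/P]. A
    prime above [P] that misses all [F n] has an image meeting every one of these spans trivially,
    so this image is zero. *)
Lemma rational_isolated (P : spec R) : rational P ->
  exists F : nat -> R, (forall n, ~ (P : set R) (F n)) /\
    forall Q : spec R, P `<=` Q -> (forall n, ~ (Q : set R) (F n)) -> Q = P.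
Proof.
move=> [Q0 [phi [Qq Qa]]].
have [e eP] := @quot_spec_countable k R P R_countable.
have /choice[F FP] : forall n, exists x, quot_pi P x <> 0 /\
    forall I : set (quot_spec P), prime_ideal I -> ~ I (quot_pi P x) ->
    forall u, lspan (mkseq e n) u -> I u -> u = 0.
  move=> n; have [f f0 fP] := avoided_lspan (@quot_spec_noetherian k R P R_noeth)
    (@quot_spec_prime k R P) Qq Qa (mkseq e n).
  by have [x xf] := quot_pi_surj f; exists x; rewrite xf.
exists F; split=> [n /quot_pi0|Q PQ QF]; first by case: (FP n).
apply: spec_inj; apply/seteqP; split=> // x Qx.
have [pI Ipi] := quot_image_prime PQ.
have [n xn] := eP (quot_pi P x); apply/quot_pi0.
by apply: (proj2 (FP n) _ pI) xn _ => /=; rewrite Ipi.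
Qed.

Lemma rational_locally_closed (P : spec R) (X : set (spec R)) :
  rational P -> X P -> locally_closed X -> affine_spectrum k (set_type X) ->
  locally_closed [set P].
Proof.
move=> ratP XP [U [F [oU cF XE]]] [noX|[A [Afg [f [g [fc gc fK gK]]]]]].
  by case: noX; exact: (SigSub (mem_set XP)).
pose P' : set_type X := SigSub (mem_set XP).
pose p := f P'.
have valc : continuous (set_val : set_type X -> spec R) by exact: initial_continuous.
have gclosed (C : set (spec R)) : closed C -> closed [set q : spec A | C (set_val (g q))].
  move=> cC; have /continuous_closedP gC := gc; apply: (gC [set x | C (set_val x)]).
  by move/continuous_closedP: valc => /(_ C cC).
have gp : set_val (g p) = P by rewrite /p fK.
have [E [nE Eisol]] := rational_isolated ratP.
(* The points of [spec A] whose prime of [R] contains [E n] form a closed set that misses [p]; [a n]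
   is an element of its defining ideal outside [p]. *)
have /choice[a aP] : forall n, exists x, ~ (p : set A) x /\
    forall q : spec A, (set_val (g q) : set R) (E n) -> (q : set A) x.
  move=> n; have /zariski_closedP[J iJ JE] := gclosed _ (@closed_contains (E n)).
  have : ~ zero_locus J p by rewrite -JE /= gp; exact: nE.
  move=> /existsNP[x /not_implyP[Jx npx]]; exists x; split=> // q qE.
  have : zero_locus J q by rewrite -JE.
  by apply.
have cp : closed [set p].
  apply: (affine_point_closed k_uncountable (finitely_generated_countable Afg) (a := a)).
    by move=> n; case: (aP n).
  move=> q pq qa; suff -> : q = p by [].
  rewrite -[q]gK /p; congr f; apply: val_inj; rewrite /= -/(set_val _).
  apply: Eisol => [|n gqE]; last by apply: (qa n); case: (aP n) => _; apply.
  (* Inclusion of primes passes through the homeomorphism: the primes above [P] pull back to a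
     closed set containing [p], hence every [q] above [p]. *)
  have cP : closed [set Q : spec R | P `<=` Q].
    by apply/zariski_closedP; exists (P : set R) => //; case: (spec_prime P).
  have /zariski_closedP[J iJ JE] := gclosed _ cP.
  have : zero_locus J q; last by rewrite -JE.
  have : zero_locus J p by rewrite -JE /= gp.
  by move=> Jp; exact: subset_trans pq.
have : closed (f @^-1` [set p]) by move/continuous_closedP: fc; apply.
(* [V] is open in the whole spectrum and cuts out of [X] exactly the complement of [P], so removing
   [V] from [X] leaves [P] alone. *)
rewrite -openC => -[V oV VE].
exists U, (F `&` ~` V); split=> //; first by apply: closedI => //; rewrite closedC.
rewrite setIA -XE; apply/seteqP; split=> [_ ->|Q [XQ nVQ]].
  split=> // VP; have : (set_val @^-1` V) P' by [].
  by rewrite VE; apply.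
pose Q' : set_type X := SigSub (mem_set XQ).
have : ~ (set_val @^-1` V) Q' by [].
rewrite VE => /contrapT /= fQ.
by have /(congr1 set_val) : Q' = P' by rewrite -[Q']fK fQ fK.
Qed.

End RationalLocallyClosed.

(** * The three implications closed into a cycle *)

Unset Implicit Arguments.

Theorem theorem1p2 (k : fieldType) (R : algType k) (d : nat)
    (X : 'I_d -> set (spec R))
    (k_uncountable : ~ countable [set: k])
    (R_fg : finitely_generated R)
    (R_noeth : left_noetherian R)
    (X_disjoint : trivIset [set: 'I_d] X)
    (X_cover : \bigcup_i X i = [set: spec R])
    (X_lc : forall i, locally_closed (X i))
    (X_affine : forall i, affine_spectrum k (set_type (X i))) :
  dixmier_moeglin R.
Proof.
have Rc := finitely_generated_countable R_fg.
(* Local closedness of [P] is obtained inside the stratum that contains it. *)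
have rat_lc (P : spec R) : rational P -> locally_closed [set P].
  move=> ratP; have : [set: spec R] P by [].
  rewrite -X_cover => -[i _ XiP].
  exact: (rational_locally_closed k_uncountable Rc R_noeth ratP XiP).
move=> P; have lc_prim := @locally_closed_primitive k R k_uncountable Rc R_noeth P.
have prim_rat := @primitive_rational k R P k_uncountable Rc R_noeth.
split; split=> //; first by move=> /prim_rat/rat_lc.
by move=> /rat_lc/lc_prim.
Qed.
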